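(* Let $(M^n,g,V,\lambda)$ be a Ricci soliton whose scalar curvature $S$ satisfies $\Delta_V S\ge 0$. Then $$0\le S\le\frac{n\lambda}{2}\quad\text{or}\quad \frac{n\lambda}{2}\le S\le 0.$$ Further: (1) if $\lambda=0$ or $S=0$, then $M$ is Ricci flat; (2) if $S=\frac{n\lambda}{2}$, then $M$ is Einstein. In particular, the conclusion holds for solitons of constant scalar curvature.
   Context: A Ricci soliton is a quadruple $(M^n,g,V,\lambda)$ where $(M^n,g)$ is a complete $n$-dimensional Riemannian manifold, $V$ is a complete (smooth) vector field on $M$, and $\lambda\in\mathbb{R}$, satisfying $\frac12\mathcal{L}_V g+\mathrm{Ric}=\frac{\lambda}{2}g$, where $\mathcal{L}_V$ is the Lie derivative along $V$ and $\mathrm{Ric}$ is the Ricci tensor of $(M,g)$. The drifted Laplacian is $\Delta_V u=\Delta u-g(V,\nabla u)$, with $\Delta$ the Laplace–Beltrami operator. *)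

(* Defs.v *)
From HB Require Import structures.
From mathcomp Require Import all_boot all_order all_algebra.
From mathcomp Require Import all_classical all_reals all_analysis.

Set Implicit Arguments.
Unset Strict Implicit.
Unset Printing Implicit Defensive.

Import Order.TTheory GRing.Theory Num.Theory.
Import numFieldNormedType.Exports.

Local Open Scope classical_set_scope.
Local Open Scope ring_scope.

(** Points and vectors of R^n are row vectors; with this convention the library
    Jacobian ['J f x] has entry [∂_a f^b (x)] in row [a] and column [b]. *)

Section calculus.
Context {R : realType} {n : nat}.

Definition partial (i : 'I_n) (f : 'rV[R]_n -> R) : 'rV[R]_n -> R :=
  fun x => 'D_(delta_mx 0 i) f x.

(** C^oo on an open set [U]: all iterated partial derivatives exist and are
    continuous at the points of [U]. *)
Definition smooth_on (U : set 'rV[R]_n) (f : 'rV[R]_n -> R) : Prop :=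
  forall (s : seq 'I_n) (x : 'rV[R]_n), U x ->
    {for x, continuous (foldr partial f s)} /\
    (forall i : 'I_n, derivable (foldr partial f s) x (delta_mx 0 i)).

End calculus.

(** A homeomorphism from an open subset of [M] onto an open subset of R^n.  The
    values of [to_coord] outside [chart_dom] and of [of_coord] outside
    [to_coord @` chart_dom] are irrelevant. *)
Record chart (R : realType) (n : nat) (M : topologicalType) := Chart {
  chart_dom : set M;
  to_coord : M -> 'rV[R]_n;
  of_coord : 'rV[R]_n -> M;
  chart_dom_open : open chart_dom;
  chart_img_open : open (to_coord @` chart_dom);
  to_coordK : forall p, chart_dom p -> of_coord (to_coord p) = p;
  to_coord_cts : forall p, chart_dom p -> {for p, continuous to_coord};
  of_coord_cts :
    forall x, (to_coord @` chart_dom) x -> {for x, continuous of_coord} }.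

Definition transition (R : realType) (n : nat) (M : topologicalType)
    (c d : chart R n M) : 'rV[R]_n -> 'rV[R]_n :=
  fun x => to_coord d (of_coord c x).

(** The domain of [transition c d]. *)
Definition overlap (R : realType) (n : nat) (M : topologicalType)
    (c d : chart R n M) : set 'rV[R]_n :=
  to_coord c @` (chart_dom c `&` chart_dom d).

(** The atlas need not be maximal: tensor fields are determined by their
    components in any atlas of the smooth structure. *)
Record manifold (R : realType) (n : nat) := Manifold {
  carrier :> topologicalType;
  carrier_hausdorff : hausdorff_space carrier;
  carrier_second_countable : @second_countable carrier;
  atlas : Type;
  chart_of : atlas -> chart R n carrier;
  atlas_cover : forall p : carrier, exists i : atlas, chart_dom (chart_of i) p;
  atlas_compat : forall (i j : atlas) (b : 'I_n),
    smooth_on (overlap (chart_of i) (chart_of j))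
      (fun x => transition (chart_of i) (chart_of j) x 0 b) }.

Arguments atlas {R n} M : rename.
Arguments chart_of {R n} M i : rename.

Section tensor_fields.
Context {R : realType} {n : nat} (M : manifold R n).

Definition dom (i : atlas M) : set M := chart_dom (chart_of M i).

Definition coord (i : atlas M) : M -> 'rV[R]_n := to_coord (chart_of M i).

Definition coord_img (i : atlas M) : set 'rV[R]_n := coord i @` dom i.

(** Some chart of the atlas around [p]. *)
Definition chart_at (p : M) : atlas M := projT1 (cid (atlas_cover p)).

(** Tensor fields are given by their components in the charts of the atlas,
    subject to the transformation law on overlaps; [vf i x] is the row of
    components [V^a] and [metric i x] the matrix of components [g_ab] at the
    point of coordinates [x] in the chart [i]. *)
Record vector_field := VectorField {
  vf :> atlas M -> 'rV[R]_n -> 'rV[R]_n;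
  vf_smooth : forall (i : atlas M) (a : 'I_n),
    smooth_on (coord_img i) (fun x => vf i x 0 a);
  vf_compat : forall (i j : atlas M) (x : 'rV[R]_n),
    overlap (chart_of M i) (chart_of M j) x ->
    let t := transition (chart_of M i) (chart_of M j) in
    vf j (t x) = vf i x *m 'J t x }.

Record riemannian_metric := RiemannianMetric {
  metric :> atlas M -> 'rV[R]_n -> 'M[R]_n;
  metric_smooth : forall (i : atlas M) (a b : 'I_n),
    smooth_on (coord_img i) (fun x => metric i x a b);
  metric_sym : forall (i : atlas M) (x : 'rV[R]_n),
    coord_img i x -> (metric i x)^T = metric i x;
  metric_pos : forall (i : atlas M) (x : 'rV[R]_n), coord_img i x ->
    forall v : 'rV[R]_n, v != 0 -> 0 < (v *m metric i x *m v^T) 0 0;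
  metric_compat : forall (i j : atlas M) (x : 'rV[R]_n),
    overlap (chart_of M i) (chart_of M j) x ->
    let t := transition (chart_of M i) (chart_of M j) in
    metric i x = 'J t x *m metric j (t x) *m ('J t x)^T }.

End tensor_fields.

(** Component formulas on an open subset of R^n, for a metric [g] and a vector
    field [V] given by their components there. *)
Section local_formulas.
Context {R : realType} {n : nat}.
Implicit Types (g : 'rV[R]_n -> 'M[R]_n) (V : 'rV[R]_n -> 'rV[R]_n).
Implicit Types (f : 'rV[R]_n -> R) (x : 'rV[R]_n) (i j k l : 'I_n).

Definition dmetric g k i j x : R := partial k (fun y => g y i j) x.

(** Γ^k_ij *)
Definition christoffel g k i j x : R :=
  2^-1 * \sum_l invmx (g x) k l *
    (dmetric g i j l x + dmetric g j i l x - dmetric g l i j x).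

(** R^l_ijk, where R(∂_i, ∂_j) ∂_k = R^l_ijk ∂_l and
    R(X, Y) = [∇_X, ∇_Y] - ∇_[X, Y]. *)
Definition riemann g l i j k x : R :=
  partial i (christoffel g l j k) x - partial j (christoffel g l i k) x
  + \sum_p (christoffel g l i p x * christoffel g p j k x
            - christoffel g l j p x * christoffel g p i k x).

(** Ric(Y, Z) is the trace of X |-> R(X, Y) Z. *)
Definition ricci_local g x : 'M[R]_n :=
  \matrix_(j, k) \sum_i riemann g i i j k x.

Definition scalar_local g x : R :=
  \sum_j \sum_k invmx (g x) j k * ricci_local g x j k.

(** (L_V g)_ij = V^k ∂_k g_ij + g_kj ∂_i V^k + g_ik ∂_j V^k *)
Definition lie_metric_local g V x : 'M[R]_n :=
  \matrix_(i, j) \sum_k (V x 0 k * dmetric g k i j x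
    + g x k j * partial i (fun y => V y 0 k) x
    + g x i k * partial j (fun y => V y 0 k) x).

Definition gradient_local g f x : 'rV[R]_n :=
  \row_i \sum_j invmx (g x) i j * partial j f x.

(** The trace of ∇V. *)
Definition divergence_local g V x : R :=
  \sum_i (partial i (fun y => V y 0 i) x
          + \sum_k christoffel g i i k x * V x 0 k).

Definition laplacian_local g f x : R :=
  divergence_local g (gradient_local g f) x.

Definition drifted_laplacian_local g V f x : R :=
  laplacian_local g f x - (V x *m g x *m (gradient_local g f x)^T) 0 0.

End local_formulas.

Section solitons.
Context {R : realType} {n : nat} {M : manifold R n}.
Implicit Types (g : riemannian_metric M) (V : vector_field M).

Definition ricci g (i : atlas M) : 'rV[R]_n -> 'M[R]_n := ricci_local (g i).

Definition lie_metric V g (i : atlas M) : 'rV[R]_n -> 'M[R]_n :=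
  lie_metric_local (g i) (V i).

(** The next two are invariant under change of coordinates, so the choice made
    by [chart_at] does not affect their values (for smooth [u]). *)
Definition scalar_curvature g (p : M) : R :=
  scalar_local (g (chart_at p)) (coord (chart_at p) p).

Definition drifted_laplacian g V (u : M -> R) (p : M) : R :=
  let i := chart_at p in
  drifted_laplacian_local (g i) (V i)
    (fun x => u (of_coord (chart_of M i) x)) (coord i p).

Definition integral_curve V (c : R -> M) : Prop :=
  continuous c /\
  forall (i : atlas M) (t : R), dom i (c t) ->
    is_derive t 1 (coord i \o c) (V i (coord i (c t))).

Definition complete_vector_field V : Prop :=
  forall p : M, exists c : R -> M, integral_curve V c /\ c 0 = p.

Definition geodesic g (c : R -> M) : Prop :=
  continuous c /\
  forall (i : atlas M) (t : R), dom i (c t) ->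
    let x := coord i \o c in
    derivable x t 1 /\
    is_derive t 1 (derive1 x)
      (- \row_k \sum_a \sum_b
           christoffel (g i) k a b (x t) * derive1 x t 0 a * derive1 x t 0 b).

(** Geodesic completeness, with initial velocities given by their components in
    any chart around the initial point. *)
Definition complete_metric g : Prop :=
  forall (i : atlas M) (p : M), dom i p -> forall v : 'rV[R]_n,
    exists c : R -> M,
      [/\ geodesic g c, c 0 = p & derive1 (coord i \o c) 0 = v].

Definition ricci_soliton g V (lambda : R) : Prop :=
  [/\ complete_metric g,
      complete_vector_field V &
      forall (i : atlas M) (x : 'rV[R]_n), coord_img i x ->
        2^-1 *: lie_metric V g i x + ricci g i x = (lambda / 2) *: g i x].

Definition ricci_flat g : Prop :=
  forall (i : atlas M) (x : 'rV[R]_n), coord_img i x -> ricci g i x = 0.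

Definition einstein g : Prop :=
  exists k : R, forall (i : atlas M) (x : 'rV[R]_n),
    coord_img i x -> ricci g i x = k *: g i x.

End solitons.

(* Main.v *)
(** The scalar curvature [S] of a soliton satisfies the pointwise identity
    [Δ_V S = λ S - 2 |Ric|^2], so that [Δ_V S >= 0] and Cauchy-Schwarz
    [S^2 <= n |Ric|^2] give [S (n λ / 2 - S) >= 0] at every point, and the two
    rigidity statements are the equality cases.

    For the identity, lower the index of [V]: [∇V = λ/2 g - Ric + W] with [W]
    antisymmetric. The trace of [[∇_i, ∇_j] V = R_ij V] and the contracted Bianchi
    identity turn the divergence of this equation into
    [div W = - dS / 2 + Ric(V)]. The double divergence of an antisymmetric tensor
    vanishes, whence [ΔS = 2 div (Ric(V)) = V S + 2 <Ric, ∇V>], and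
    [2 <Ric, ∇V> = λ S - 2 |Ric|^2] since [W] is orthogonal to [Ric].

    These computations are carried out in a commutative ring with commuting
    derivations, here the ring of smooth functions on the image of a chart.
    Independence of the chart is only needed for [L_V g]: the soliton equation
    transfers it to [Ric] and [S]. *)

Require Import Defs.
From HB Require Import structures.
From mathcomp Require Import all_boot all_order all_algebra.
From mathcomp Require Import ring lra.
From mathcomp Require Import all_classical all_reals all_analysis.

Set Implicit Arguments.
Unset Strict Implicit.
Unset Printing Implicit Defensive.

Import Order.TTheory GRing.Theory Num.Theory.
Import numFieldNormedType.Exports.
Local Open Scope classical_set_scope.
Local Open Scope ring_scope.

(** * Tensor calculus over a ring with commuting derivations *)

(** A connection is a family of matrices [G a] acting on columns, so that covariant differentiation
    of a vector is [dmx a V + G a *m V] and tensor identities become matrix identities that [ring]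
    settles entry by entry. Of the Christoffel formula only metric compatibility and vanishing
    torsion enter the tensor calculus. The abstract ring has its price in analysis. Commuting
    derivations amount to Schwarz's theorem, and an inverse metric inside the ring to smoothness of
    the reciprocal of a nowhere vanishing function. Since smoothness is defined by iterated partial
    derivatives, the chain rule behind a change of coordinates requires deducing differentiability
    from continuous partial derivatives. Passing between charts through [L_V g] pays off because it
    involves only first derivatives of [g] and [V]: a transformation law for Christoffel symbols or
    for curvature would involve higher derivatives of the transition map. *)

Section calculus.
Context {A : comPzRingType} {n : nat} {D : 'I_n -> A -> A}.
Hypothesis derD : forall i x y, D i (x + y) = D i x + D i y.
Hypothesis derM : forall i x y, D i (x * y) = D i x * y + x * D i y.
Hypothesis derC : forall i j x, D i (D j x) = D j (D i x).
Context (half : A).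
Hypothesis half2 : half + half = 1.

Implicit Types (X Y Z : 'M[A]_n) (i j k l a b c m : 'I_n).

Lemma double_inj (x y : A) : x + x = y + y -> x = y.
Proof.
move=> e; rewrite -[x]mul1r -[y]mul1r -half2 !mulrDl -!mulrDr.
by rewrite e.
Qed.

(** Inserts a vanishing expression as a summand, so that the remaining goal is a pure [ring]
    identity. *)
Lemma eq_add0l (x y e : A) : 0 = e -> x + e = y -> x = y.
Proof. by move=> <-; rewrite addr0. Qed.

Lemma der0 i : D i 0 = 0.
Proof. by apply: (addrI (D i 0)); rewrite -derD !addr0. Qed.

Lemma derN i x : D i (- x) = - D i x.
Proof. by apply: (addrI (D i x)); rewrite -derD !subrr der0. Qed.

Lemma derB i x y : D i (x - y) = D i x - D i y.
Proof. by rewrite derD derN. Qed.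

Lemma der_sum i (I : Type) (r : seq I) (Q : pred I) (F : I -> A) :
  D i (\sum_(j <- r | Q j) F j) = \sum_(j <- r | Q j) D i (F j).
Proof. by apply: (big_morph _ (derD i) (der0 i)). Qed.

Lemma der1 i : D i 1 = 0.
Proof. by apply: (addrI (D i 1)); rewrite addr0 -{3}[1]mulr1 derM mulr1 mul1r. Qed.

Lemma der_half i : D i half = 0.
Proof. by apply: double_inj; rewrite -derD half2 der1 addr0. Qed.

Definition dmx {p q} i (X : 'M[A]_(p, q)) : 'M[A]_(p, q) := map_mx (D i) X.

Lemma dmxD {p q} i (X Y : 'M[A]_(p, q)) : dmx i (X + Y) = dmx i X + dmx i Y.
Proof. by apply/matrixP=> a b; rewrite !mxE derD. Qed.

Lemma dmxN {p q} i (X : 'M[A]_(p, q)) : dmx i (- X) = - dmx i X.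
Proof. by apply/matrixP=> a b; rewrite !mxE derN. Qed.

Lemma dmxM {p q r} i (X : 'M[A]_(p, q)) (Y : 'M[A]_(q, r)) : dmx i (X *m Y) = dmx i X
  *m Y + X *m dmx i Y.
Proof.
apply/matrixP=> a b; rewrite !mxE der_sum -big_split; apply: eq_bigr => c _.
by rewrite !mxE derM.
Qed.

Lemma dmxC {p q} i j (X : 'M[A]_(p, q)) : dmx i (dmx j X) = dmx j (dmx i X).
Proof. by apply/matrixP=> a b; rewrite !mxE derC. Qed.

Lemma dmx_tr i X : dmx i X^T = (dmx i X)^T.
Proof. by apply/matrixP=> a b; rewrite !mxE. Qed.

Lemma dmx1 i : dmx i (1%:M : 'M[A]_n) = 0.
Proof. by apply/matrixP=> a b; rewrite !mxE; case: (a == b); rewrite ?der1 ?der0. Qed.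

Lemma mxD {p q} (X Y : 'M[A]_(p, q)) (s : 'I_p) (t : 'I_q) : (X + Y) s t = X s t + Y
  s t.
Proof. by rewrite mxE. Qed.
Lemma mxN {p q} (X : 'M[A]_(p, q)) (s : 'I_p) (t : 'I_q) : (- X) s t = - X s t.
Proof. by rewrite mxE. Qed.

Lemma mx0 {p q} (s : 'I_p) (t : 'I_q) : (0 : 'M[A]_(p, q)) s t = 0.
Proof. by rewrite mxE. Qed.

Lemma mxT X a b : X^T a b = X b a.
Proof. by rewrite mxE. Qed.

Lemma mxM {p q r} (X : 'M[A]_(p, q)) (Y : 'M[A]_(q, r)) (s : 'I_p) (t : 'I_r) : (X *m
  Y) s t = \sum_c X s c * Y c t.
Proof. by rewrite mxE. Qed.

Lemma dmxE {p q} i (X : 'M[A]_(p, q)) (s : 'I_p) (t : 'I_q) : dmx i X s t = D i (X s t).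
Proof. by rewrite mxE. Qed.

(** * The Levi-Civita connection *)

Section levi_civita.
Context (g h : 'M[A]_n).
Hypothesis g_sym : g^T = g.
Hypothesis gh : g *m h = 1%:M.

(** The upper index is the row: the matrix for fixed [i] is the zeroth-order part of ∇_i on column
    vectors. *)
Definition levi_civita i : 'M[A]_n := \matrix_(k, j)
  (half * \sum_l h k l * (D i (g j l) + D j (g i l) - D l (g i j))).

Lemma levi_civita_tf i k j : levi_civita i k j = levi_civita j k i.
Proof.
rewrite !mxE; congr (_ * _); apply: eq_bigr => l _.
by rewrite (addrC (D i _)) -(mxT g j i) g_sym.
Qed.

Lemma levi_civita_metric a :
  dmx a g = (levi_civita a)^T *m g + g *m levi_civita a.
Proof.
(* Lowering the upper index gives the Christoffel symbols of the first kind, as [g *m h] collapses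
   the sum. In the sum with the transpose, two of the three derivatives cancel. *)
have E p k : (g *m levi_civita a) p k =
    half * (D a (g k p) + D k (g a p) - D p (g a k)).
  rewrite mxM; under eq_bigr do rewrite mxE mulrCA mulr_sumr.
  rewrite -mulr_sumr exchange_big; congr (_ * _).
  transitivity (\sum_l (1%:M : 'M[A]_n) p l *
      (D a (g k l) + D k (g a l) - D l (g a k))).
    apply: eq_bigr => l _; rewrite -gh mxM mulr_suml.
    by apply: eq_bigr => q _; rewrite mulrA.
  rewrite (bigD1 p) //= mxE eqxx mul1r big1 ?addr0 // => i ip.
  by rewrite mxE eq_sym (negPf ip) mul0r.
apply/matrixP => p k; rewrite mxD dmxE -[(levi_civita a)^T *m g]trmxK.
rewrite trmx_mul trmxK g_sym mxT !E -(mxT g p k) g_sym.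
rewrite -[LHS]mul1r -half2; ring.
Qed.

End levi_civita.

(** [G a k b] is the Christoffel symbol Γ^k_ab. *)
Context (G : 'I_n -> 'M[A]_n).

(** The curvature two-form dG + G ∧ G: this matrix is the endomorphism R(∂_b, ∂_c), with R^l_bck in
    row l and column k. *)
Definition curvature b c : 'M[A]_n :=
  dmx b (G c) - dmx c (G b) + (G b *m G c - G c *m G b).

Lemma curvatureE b c l k : curvature b c l k = D b (G c l k) - D c (G b l k) +
  (\sum_q G b l q * G c q k - \sum_q G c l q * G b q k).
Proof. by rewrite /curvature !(mxD, mxN) !dmxE !mxM. Qed.

(** Only the endomorphism indices are differentiated covariantly. Corrections for the form indices
    [b] and [c] would cancel in the cyclic sum without torsion; omitting them makes the Bianchi
    identity valid for arbitrary matrices [G]. *)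
Definition cov_curvature a b c : 'M[A]_n :=
  dmx a (curvature b c) + (G a *m curvature b c - curvature b c *m G a).

Lemma bianchi a b c : cov_curvature a b c + cov_curvature b c a + cov_curvature c a b
  = 0.
Proof.
rewrite /cov_curvature /curvature; apply/matrixP => l k.
(* Once products are expanded and associated to the left, the entry of each monomial is an atom, so
   the commutative [ring] can decide a noncommutative identity. *)
rewrite !(dmxD, dmxN, dmxM, mulmxDl, mulmxDr, mulmxN, mulNmx, mulmxA).
rewrite (dmxC b a) (dmxC c a) (dmxC c b) !(mxD, mxN) !mx0.
ring.
Qed.

Lemma curvatureN b c : curvature b c = - curvature c b.
Proof. by rewrite /curvature !opprD !opprK (addrC (- dmx c _)) (addrC (- _)). Qed.

Context (h g : 'M[A]_n).
Hypothesis h_sym : h^T = h.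
Hypothesis g_sym : g^T = g.
Hypothesis gh : g *m h = 1%:M.
Hypothesis hg : h *m g = 1%:M.
Hypothesis der_metric : forall a, dmx a g = (G a)^T *m g + g *m G a.
Hypothesis torsion_free : forall a k l, G a l k = G k l a.

Lemma der_inverse_metric a : dmx a h = - (G a *m h + h *m (G a)^T).
Proof.
have e1 : h *m (g *m dmx a h) = dmx a h by rewrite mulmxA hg mul1mx.
have e2 : h *m (dmx a g *m h) = h *m (G a)^T + G a *m h.
  by rewrite der_metric mulmxDl mulmxDr -(mulmxA _ g) gh mulmx1 !mulmxA hg mul1mx.
have : h *m dmx a (g *m h) = 0 by rewrite gh dmx1 mulmx0.
rewrite dmxM mulmxDr e1 e2 addrC => /eqP.
by rewrite addr_eq0 (addrC (h *m _)) => /eqP.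
Qed.

(** Raising the second index of the endomorphism [curvature b c] makes metric
    compatibility an antisymmetry. *)
Definition raised_curvature b c := curvature b c *m h.

Lemma raised_curvatureN b c : raised_curvature b c = - raised_curvature c b.
Proof. by rewrite /raised_curvature curvatureN mulNmx. Qed.

(** The Ricci identity for the parallel tensor [h]: expanding both orders of its second derivatives
    through [G] leaves the curvature acting on the two indices of [h], and the orders agree. *)
Lemma raised_curvature_antisym b c : (raised_curvature b c)^T = - raised_curvature b c.
Proof.
apply/eqP; rewrite -addr_eq0; apply/eqP.
have := dmxC b c h; rewrite (der_inverse_metric c) (der_inverse_metric b) !dmxN !dmxD
  !dmxM !dmx_tr (der_inverse_metric c) (der_inverse_metric b).
move=> /(congr1 (fun X : 'M[A]_n => - X)); rewrite !opprK => E.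
rewrite /raised_curvature trmx_mul h_sym /curvature !(raddfD, raddfN) /= !trmx_mul.
rewrite !(mulmxDl, mulmxDr, mulmxN, mulNmx, mulmxA) in E *.
apply/matrixP => l k; move/matrixP/(_ l k): E.
rewrite mx0 !(mxD, mxN) => /eqP; rewrite -subr_eq0 => /eqP E.
rewrite -[RHS]E; ring.
Qed.

(** Raising an index commutes with covariant differentiation because [h] is parallel. *)
Lemma raised_bianchi a b c l k :
  let T a b c := dmx a (raised_curvature b c) + G a *m raised_curvature b c +
    raised_curvature b c *m (G a)^T in
  (T a b c) l k + (T b c a) l k + (T c a b) l k = 0.
Proof.
move=> T; have TE x y z : T x y z = cov_curvature x y z *m h.
  rewrite /T /raised_curvature /cov_curvature dmxM der_inverse_metric !(mulmxDl,
    mulmxDr, mulmxN, mulNmx, mulmxA, opprD).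
  apply/matrixP => s t; rewrite !(mxD, mxN); ring.
by rewrite -!mxD !TE -!mulmxDl bianchi mul0mx mxE.
Qed.

Lemma sum_antisym_sym (f s : 'I_n -> 'I_n -> A) :
  (forall i j, f i j = - f j i) -> (forall i j, s i j = s j i) ->
  \sum_i \sum_j f i j * s i j = 0.
Proof.
move=> fN sC; apply: double_inj; rewrite {1}exchange_big /= -big_split /= addr0.
apply: big1 => i _; rewrite -big_split big1 // => j _ /=.
by rewrite fN sC mulNr addNr.
Qed.

(** Γ^l_lm, classically ∂_m log √det g: the term that turns a coordinate divergence into the
    Riemannian one. *)
Definition conn_trace m := \sum_l G l l m.
Definition ricci_mx : 'M[A]_n := \matrix_(j, k) \sum_i curvature i j i k.
(** The mixed tensor Ric_c^k with the lower index as row; its trace is the scalar curvature. *)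
Definition ricci_op := ricci_mx *m h.

Lemma ricci_opE c k : ricci_op c k = \sum_l raised_curvature l c l k.
Proof.
rewrite mxE; under eq_bigr do rewrite mxE mulr_suml.
by rewrite exchange_big /=; apply: eq_bigr => l _; rewrite mxE.
Qed.

(** The divergence of a mixed tensor, where [T c l] stands for T_c^l. *)
Definition div_mx (T : 'M[A]_n) c :=
  \sum_l D l (T c l) + \sum_m conn_trace m * T c m - \sum_l \sum_m G c l m * T l m.

(** The Bianchi identity for the indices l, k, c is summed at the entry (l, k). *)
Lemma contracted_bianchi c : div_mx ricci_op c + div_mx ricci_op c = D c (\tr ricci_op).
Proof.
have Kmx b d i j : raised_curvature b d i j = - raised_curvature b d j i.
  by have /matrixP/(_ j i) := raised_curvature_antisym b d; rewrite mxN mxE.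
(* The first two cyclic terms each contract to minus the divergence of Ric, and the third to dS. The
   two minus signs have different origins: antisymmetry of the matrix for [K1], antisymmetry in the
   form indices for [K2]. *)
have K1 l : \sum_k raised_curvature k c l k = - ricci_op c l.
  rewrite ricci_opE -sumrN; apply: eq_bigr => k _.
  exact: Kmx.
have K2 k : \sum_l raised_curvature c l l k = - ricci_op c k.
  by rewrite ricci_opE -sumrN; apply: eq_bigr => l _; rewrite raised_curvatureN mxN.
have : \sum_l \sum_k (
    (dmx l (raised_curvature k c) + G l *m raised_curvature k c + raised_curvature k
    c *m (G l)^T) l k +
    (dmx k (raised_curvature c l) + G k *m raised_curvature c l + raised_curvature c
    l *m (G k)^T) l k +
    (dmx c (raised_curvature l k) + G c *m raised_curvature l k + raised_curvature l
    k *m (G c)^T) l k) = 0.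
  by apply: big1 => l _; apply: big1 => k _; exact: raised_bianchi.
under eq_bigr do under eq_bigr do rewrite !mxD.
under eq_bigr do rewrite !big_split /=.
rewrite !big_split /=.
have -> : \sum_l \sum_k dmx l (raised_curvature k c) l k = - \sum_l D l (ricci_op c l).
  rewrite -sumrN; apply: eq_bigr => l _; rewrite -derN -K1 der_sum.
  by apply: eq_bigr => k _; rewrite mxE.
have -> : \sum_l \sum_k (G l *m raised_curvature k c) l k = - \sum_m conn_trace m *
  ricci_op c m.
  under eq_bigr do under eq_bigr do rewrite mxM.
  under eq_bigr do rewrite exchange_big /=.
  rewrite exchange_big /= -sumrN; apply: eq_bigr => m _.
  rewrite -mulrN -K1 mulr_suml; apply: eq_bigr => l _.
  by rewrite mulr_sumr.
(* The curvature is antisymmetric in the two indices in which the torsion-free symbol is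
   symmetric. *)
have -> : \sum_l \sum_k (raised_curvature k c *m (G l)^T) l k = 0.
  rewrite exchange_big big1 //= => k _.
  under eq_bigr do rewrite mxM.
  under eq_bigr do under eq_bigr do rewrite mxT.
  by apply: (@sum_antisym_sym (raised_curvature k c) (fun i j => G i k j)) => i j;
    [exact: Kmx|exact: torsion_free].
have -> : \sum_l \sum_k dmx k (raised_curvature c l) l k = - \sum_l D l (ricci_op c l).
  rewrite exchange_big -sumrN; apply: eq_bigr => k _; rewrite -derN -K2 der_sum.
  by apply: eq_bigr => l _; rewrite mxE.
have -> : \sum_l \sum_k (G k *m raised_curvature c l) l k = 0.
  apply: big1 => l _.
  under eq_bigr do rewrite mxM.
  under eq_bigr do under eq_bigr do rewrite mulrC.
  rewrite exchange_big.
  by apply: (@sum_antisym_sym (raised_curvature c l) (fun i j => G j l i)) => i j;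
    [exact: Kmx|exact: torsion_free].
have -> : \sum_l \sum_k (raised_curvature c l *m (G k)^T) l k = - \sum_m conn_trace m
  * ricci_op c m.
  under eq_bigr do under eq_bigr do rewrite mxM.
  under eq_bigr do under eq_bigr do under eq_bigr do rewrite mxT mulrC.
  rewrite -sumrN; under eq_bigr do rewrite exchange_big /=.
  rewrite exchange_big /=; apply: eq_bigr => m _.
  rewrite -mulrN -K2 mulr_sumr; apply: eq_bigr => l _.
  by rewrite mulr_suml.
have -> : \sum_l \sum_k dmx c (raised_curvature l k) l k = D c (\tr ricci_op).
  rewrite exchange_big der_sum; apply: eq_bigr => k _; rewrite ricci_opE der_sum.
  by apply: eq_bigr => l _; rewrite mxE.
have -> : \sum_l \sum_k (G c *m raised_curvature l k) l k = \sum_l \sum_m G c l m *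
  ricci_op l m.
  apply: eq_bigr => l _; under eq_bigr do rewrite mxM.
  rewrite exchange_big /=; apply: eq_bigr => m _.
  rewrite ricci_opE mulr_sumr; apply: eq_bigr => k _.
  by rewrite (raised_curvatureN l k) mxN (Kmx k l m k) opprK.
have -> : \sum_l \sum_k (raised_curvature l k *m (G c)^T) l k = \sum_l \sum_m G c l m
  * ricci_op l m.
  rewrite exchange_big; apply: eq_bigr => k _; under eq_bigr do rewrite mxM.
  rewrite exchange_big /=; apply: eq_bigr => m _.
  rewrite ricci_opE mulr_sumr; apply: eq_bigr => l _.
  by rewrite mxT mulrC.
move=> E; apply: eq_add0l (esym E) _; rewrite /div_mx; ring.
Qed.

Lemma tr_antisym X Y : X^T = - X -> Y^T = Y -> \tr (X *m Y) = 0.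
Proof.
move=> XN YS; rewrite /mxtrace; under eq_bigr do rewrite mxM.
apply: (@sum_antisym_sym (fun i j => X i j) (fun i j => Y j i)) => i j.
  by rewrite -mxN -XN mxT.
by rewrite -[in LHS]YS mxT.
Qed.

Lemma conn_traceE j : conn_trace j = \tr (G j).
Proof. by apply: eq_bigr => l _; rewrite torsion_free. Qed.

(** The difference of the two sides is the trace of [curvature i j], the commutator being traceless.
    That trace pairs the antisymmetric raised curvature with the symmetric [g], hence vanishes; no
    logarithm of a determinant is involved. *)
Lemma conn_trace_closed i j : D i (conn_trace j) = D j (conn_trace i).
Proof.
have trD a X : D a (\tr X) = \tr (dmx a X).
  by rewrite der_sum; apply: eq_bigr => l _; rewrite dmxE.
have : \tr (curvature i j) = 0.
  rewrite -[curvature i j]mulmx1 -hg mulmxA.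
  by apply: tr_antisym => //; exact: raised_curvature_antisym.
rewrite !conn_traceE !trD /curvature !raddfD !raddfN /= (mxtrace_mulC (G j)) subrr
  addr0.
by move=> /eqP; rewrite subr_eq0 => /eqP.
Qed.

Definition div_vec (W : 'I_n -> A) := \sum_i D i (W i) + \sum_i conn_trace i * W i.

(** For antisymmetric [X] the remaining Christoffel term of ∇_i X^ki cancels. *)
Definition div_antisym X k := \sum_i D i (X k i) + \sum_i conn_trace i * X k i.

(** Second derivatives of [X] and products of two traces are symmetric coefficients against [X]. The
    first-order terms in [X] cancel each other, and what remains is the derivative of [conn_trace],
    symmetric by closedness. *)
Lemma div_div_antisym X : X^T = - X -> div_vec (div_antisym X) = 0.
Proof.
move=> XT; have XN i j : X i j = - X j i by rewrite -mxN -XT mxT.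
rewrite /div_vec /div_antisym.
under eq_bigr do rewrite derD !der_sum.
under [X in _ + X]eq_bigr do rewrite mulrDr !mulr_sumr.
rewrite !big_split /=.
have -> : \sum_i \sum_j D i (D j (X i j)) = 0.
  apply: double_inj; rewrite {1}exchange_big /= -big_split addr0 big1 // => i _.
  rewrite -big_split big1 // => j _.
  by rewrite /= (XN i j) derC !derN subrr.
have -> : \sum_i \sum_j conn_trace i * (conn_trace j * X i j) = 0.
  transitivity (\sum_i \sum_j X i j * (conn_trace i * conn_trace j)).
    by apply: eq_bigr => i _; apply: eq_bigr => j _; ring.
  by apply: sum_antisym_sym => // i j; rewrite mulrC.
have -> : \sum_i \sum_j conn_trace i * D j (X i j) = - \sum_i \sum_j conn_trace j * D
  i (X i j).
  rewrite exchange_big -sumrN; apply: eq_bigr => i _; rewrite -sumrN.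
  by apply: eq_bigr => j _; rewrite (XN i j) derN mulrN opprK.
under eq_bigr do under eq_bigr do rewrite derM.
under eq_bigr do rewrite big_split /=.
rewrite big_split /=.
have -> : \sum_i \sum_j D i (conn_trace j) * X i j = 0.
  under eq_bigr do under eq_bigr do rewrite mulrC.
  by apply: sum_antisym_sym => // i j; exact: conn_trace_closed.
ring.
Qed.

(** Lowering an index passes through the divergence because [g] is parallel: of the two terms of
    [dmx i g], one cancels the Christoffel correction in [div_mx] and the other pairs symmetric
    Christoffel indices with [X]. *)
Lemma div_mx_lower X j : X^T = - X ->
  div_mx (g *m X) j = \sum_k g j k * div_antisym X k.
Proof.
move=> XT; have XN a b : X a b = - X b a by rewrite -mxN -XT mxT.
rewrite /div_mx /div_antisym.
under [RHS]eq_bigr do rewrite mulrDr !mulr_sumr.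
rewrite [RHS]big_split /=.
rewrite [X in _ = X + _]exchange_big [X in _ = _ + X]exchange_big /=.
under eq_bigr do rewrite mxM der_sum.
under eq_bigr do under eq_bigr do rewrite derM.
under eq_bigr do rewrite big_split /=.
rewrite big_split /=.
have -> : \sum_m conn_trace m * (g *m X) j m = \sum_i \sum_k g j k * (conn_trace i *
  X k i).
  apply: eq_bigr => i _; rewrite mxM mulr_sumr; apply: eq_bigr => k _; ring.
have -> : \sum_i \sum_k D i (g j k) * X k i = \sum_l \sum_m G j l m * (g *m X) l m.
  under eq_bigr do under eq_bigr do rewrite -dmxE der_metric mxD mulrDl.
  under eq_bigr do rewrite big_split /=.
  rewrite big_split /= [X in _ + X](_ : _ = 0) ?addr0.
    rewrite [RHS]exchange_big /=; apply: eq_bigr => i _.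
    under eq_bigr do rewrite mxM mulr_suml.
    rewrite exchange_big /=; apply: eq_bigr => l _.
    rewrite mxM mulr_sumr; apply: eq_bigr => k _.
    by rewrite mxT torsion_free mulrA.
  under eq_bigr do under eq_bigr do rewrite mxM mulr_suml.
  under eq_bigr do rewrite exchange_big /=.
  rewrite exchange_big big1 //= => l _.
  transitivity (g j l * \sum_i \sum_k X k i * G i l k).
    rewrite mulr_sumr; apply: eq_bigr => i _; rewrite mulr_sumr.
    by apply: eq_bigr => k _; ring.
  by rewrite (@sum_antisym_sym (fun i k => X k i) (fun i k => G i l k)) ?mulr0.
ring.
Qed.

Lemma div_mxD X Y c : div_mx (X + Y) c = div_mx X c + div_mx Y c.
Proof.
rewrite /div_mx; under eq_bigr do rewrite mxD derD.
under [X in _ + X - _]eq_bigr do rewrite mxD mulrDr.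
under [X in _ - X]eq_bigr do under eq_bigr do rewrite mxD mulrDr.
under [X in _ - X]eq_bigr do rewrite big_split /=.
rewrite !big_split /=; ring.
Qed.

Lemma div_mxN X c : div_mx (- X) c = - div_mx X c.
Proof.
rewrite /div_mx; under eq_bigr do rewrite mxN derN.
under [X in _ + X - _]eq_bigr do rewrite mxN mulrN.
under [X in _ - X]eq_bigr do under eq_bigr do rewrite mxN mulrN.
under [X in _ - X]eq_bigr do rewrite sumrN.
rewrite !sumrN; ring.
Qed.

Lemma div_mx_scalar (x : A) c : (forall i, D i x = 0) -> div_mx x%:M c = 0.
Proof.
move=> Dx; rewrite /div_mx big1 ?add0r => [|l _]; last first.
  by rewrite mxE; case: eqP => _; rewrite ?mulr1n ?mulr0n ?Dx ?der0.
rewrite (bigD1 c) //= big1 ?addr0 => [|i ic]; last first.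
  by rewrite mxE eq_sym (negPf ic) mulr0n mulr0.
rewrite mxE eqxx mulr1n conn_traceE mulr_suml -sumrB big1 // => l _.
rewrite (bigD1 l) //= big1 ?addr0 => [|i il].
  by rewrite mxE eqxx mulr1n subrr.
by rewrite mxE eq_sym (negPf il) mulr0n mulr0.
Qed.

(** * Covariant derivative of a vector field *)

Context (V : 'cV[A]_n).

Definition nabla j : 'cV[A]_n := dmx j V + G j *m V.

(** The lower index of [nabla] receives no Christoffel correction; it would be symmetric in [i] and
    [j] and drop out of the commutator. *)
Lemma nabla_comm i j :
  dmx i (nabla j) + G i *m nabla j - (dmx j (nabla i) + G j *m nabla i) =
  curvature i j *m V.
Proof.
rewrite /nabla /curvature !(dmxD, dmxM) !(mulmxDl, mulmxDr, mulNmx, mulmxA).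
rewrite (dmxC j i); apply/matrixP => a b; rewrite !(mxD, mxN); ring.
Qed.

Definition nabla_mx : 'M[A]_n := \matrix_(j, i) nabla j i 0.

(** The trace of [nabla_comm] over the upper index: three of its four sums are exactly those of
    [div_mx], the fourth is the derivative of the trace. *)
Lemma div_mx_nabla j :
  div_mx nabla_mx j = D j (\tr nabla_mx) + \sum_k ricci_mx j k * V k 0.
Proof.
have -> : \sum_k ricci_mx j k * V k 0 = \sum_i (curvature i j *m V) i 0.
  under eq_bigr do rewrite mxE mulr_suml.
  by rewrite exchange_big; apply: eq_bigr => i _; rewrite mxM.
under eq_bigr do rewrite -nabla_comm !(mxD, mxN) !dmxE !mxM.
rewrite /div_mx der_sum sumrB !big_split /=.
have -> : \sum_i \sum_c G i i c * nabla j c 0 = \sum_m conn_trace m * nabla_mx j m.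
  rewrite exchange_big; apply: eq_bigr => m _ /=.
  by rewrite mulr_suml; apply: eq_bigr => i _; rewrite [nabla_mx _ _]mxE.
have -> : \sum_i \sum_c G j i c * nabla i c 0 = \sum_l \sum_m G j l m * nabla_mx l m.
  by apply: eq_bigr => l _; apply: eq_bigr => m _; rewrite [nabla_mx _ _]mxE.
have -> : \sum_i D i (nabla_mx j i) = \sum_i D i (nabla j i 0).
  by apply: eq_bigr => i _; rewrite mxE.
have -> : \sum_i D j (nabla_mx i i) = \sum_i D j (nabla i i 0).
  by apply: eq_bigr => i _; rewrite mxE.
ring.
Qed.

(** This is (L_V g)_ij = ∇_i V_j + ∇_j V_i. Metric compatibility splits the derivative of [g] into
    two halves, and zero torsion lets each complete a partial derivative of [V] to a covariant
    one. *)
Lemma lie_metric_nabla : \matrix_(i, j) \sum_k (V k 0 * D k (g i j)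
    + g k j * D i (V k 0) + g i k * D j (V k 0)) =
  nabla_mx *m g + (nabla_mx *m g)^T.
Proof.
have E i j : (nabla_mx *m g) i j = \sum_k g k j * D i (V k 0) +
    \sum_m V m 0 * ((G m)^T *m g) i j.
  rewrite mxM; under [X in _ = _ + X]eq_bigr do rewrite mxM mulr_sumr.
  rewrite [X in _ = _ + X]exchange_big -big_split; apply: eq_bigr => k _ /=.
  rewrite [nabla_mx _ _]mxE /nabla mxD dmxE [(G i *m V) _ _]mxM mulrDl mulr_suml.
  congr (_ + _); first exact: mulrC.
  by apply: eq_bigr => m _; rewrite mxT (torsion_free m); ring.
apply/matrixP => i j; rewrite mxE mxD mxT !E !big_split /=.
have -> : \sum_k V k 0 * D k (g i j) = \sum_m V m 0 * ((G m)^T *m g) i j +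
    \sum_m V m 0 * ((G m)^T *m g) j i.
  rewrite -big_split; apply: eq_bigr => m _ /=.
  rewrite -dmxE der_metric mxD mulrDr; congr (_ + _ * _).
  by rewrite -[in RHS](mxT _ i j) trmx_mul trmxK g_sym.
have -> : \sum_k g i k * D j (V k 0) = \sum_k g k i * D j (V k 0).
  by apply: eq_bigr => k _; rewrite -{1}g_sym mxT.
ring.
Qed.

(** * The soliton equation and the drifted Laplacian of the scalar curvature *)

Context (lam : A).
Hypothesis Dlam : forall i, D i lam = 0.
Hypothesis soliton : nabla_mx *m g + (nabla_mx *m g)^T + (ricci_mx + ricci_mx) = lam
  *: g.

Lemma double_inj_mx X Y : X + X = Y + Y -> X = Y.
Proof. by move=> /matrixP E; apply/matrixP => i j; apply: double_inj;
  rewrite -!mxD. Qed.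

(** Read off from the soliton equation, all of whose other terms are symmetric, instead of the first
    Bianchi identity. *)
Lemma ricci_mx_sym : ricci_mx^T = ricci_mx.
Proof.
apply: double_inj_mx; move: (congr1 trmx soliton).
rewrite !linearD /= trmxK linearZ /= g_sym -soliton (addrC _^T).
by move=> /addrI.
Qed.

Definition grad_vec (f : A) k := \sum_j h k j * D j f.

Lemma div_vecD (U W : 'I_n -> A) : div_vec (fun i => U i + W i) = div_vec U + div_vec W.
Proof.
rewrite /div_vec; under eq_bigr do rewrite derD.
under [X in _ + X]eq_bigr do rewrite mulrDr.
rewrite !big_split /=; ring.
Qed.

Lemma div_vec_ext (U W : 'I_n -> A) : U =1 W -> div_vec U = div_vec W.
Proof. by move=> UW; congr (_ + _); apply: eq_bigr => i _; rewrite UW. Qed.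

(** The Leibniz rule for div(Ric(V)): the Christoffel term subtracted in [div_mx] is the one that
    [nabla_mx] adds to the partial derivatives of [V]. *)
Lemma div_vec_ricci_op : div_vec (fun k => \sum_j ricci_op j k * V j 0) =
  \sum_j V j 0 * div_mx ricci_op j + \tr (ricci_op *m nabla_mx).
Proof.
rewrite /div_vec.
under eq_bigr do rewrite der_sum.
under eq_bigr do under eq_bigr do rewrite derM.
under eq_bigr do rewrite big_split /=.
rewrite big_split /= exchange_big [X in _ + X + _]exchange_big /=.
under [in RHS]eq_bigr do rewrite mulrBr mulrDr !mulr_sumr.
rewrite sumrB big_split /=.
have -> : \sum_i conn_trace i * (\sum_j ricci_op j i * V j 0) =
    \sum_j \sum_m V j 0 * (conn_trace m * ricci_op j m).
  under eq_bigr do rewrite mulr_sumr.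
  rewrite exchange_big; apply: eq_bigr => j _; apply: eq_bigr => m _ /=; ring.
have -> : \sum_i \sum_j D j (ricci_op i j) * V i 0 = \sum_i \sum_j V i 0 * D j
  (ricci_op i j).
  by apply: eq_bigr => j _; apply: eq_bigr => m _; rewrite mulrC.
have -> : \tr (ricci_op *m nabla_mx) = \sum_j \sum_i ricci_op j i * D i (V j 0) +
    \sum_j V j 0 * (\sum_l \sum_m G j l m * ricci_op l m).
  rewrite [X in _ = _ + X](_ : _ = \sum_l \sum_m \sum_j ricci_op l m * (G m l j * V j
    0)).
    rewrite -big_split; apply: eq_bigr => l _; rewrite mxM -big_split.
    by apply: eq_bigr => m _; rewrite [nabla_mx _ _]mxE /nabla mxD dmxE [(G m *m V) _
    _]mxM mulrDr mulr_sumr.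
  under eq_bigr do rewrite mulr_sumr.
  rewrite exchange_big; apply: eq_bigr => l _.
  under eq_bigr do rewrite mulr_sumr.
  rewrite exchange_big; apply: eq_bigr => m _ /=.
  by apply: eq_bigr => j _; rewrite (torsion_free m j); ring.
under [X in _ - X]eq_bigr do rewrite -mulr_sumr.
ring.
Qed.

Lemma soliton_identity :
  div_vec (grad_vec (\tr ricci_op)) - \sum_j V j 0 * D j (\tr ricci_op) =
  lam * \tr ricci_op - (\tr (ricci_op *m ricci_op) + \tr (ricci_op *m ricci_op)).
Proof.
pose c := half * lam.
have cc : c + c = lam by rewrite -mulrDl half2 mul1r.
have Dc i : D i c = 0 by rewrite derM der_half Dlam mul0r mulr0 addr0.
pose W := nabla_mx *m g - c *: g + ricci_mx.
have WT : W^T = - W.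
  apply/eqP; rewrite -addr_eq0; apply/eqP.
  rewrite /W !linearD linearN linearZ /= g_sym ricci_mx_sym.
  transitivity (nabla_mx *m g + (nabla_mx *m g)^T + (ricci_mx + ricci_mx) - (c *: g +
    c *: g)).
    apply/matrixP => i j; rewrite !(mxD, mxN); ring.
  by rewrite -scalerDl cc soliton subrr.
(* [W] with both indices raised, the form to which [div_div_antisym] applies; lowering one index
   again gives the summand [W *m h] of [nabla_mx]. *)
pose X := h *m W *m h.
have XT : X^T = - X.
  by rewrite /X !trmx_mul h_sym WT mulNmx mulmxN mulmxA.
have gX : g *m X = W *m h by rewrite /X !mulmxA gh mul1mx.
have nablaE : nabla_mx = W *m h + c%:M - ricci_op.
  rewrite /W /ricci_op !mulmxDl mulNmx -scalemxAl -mulmxA gh mulmx1 scalemx1.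
  by apply/matrixP => i j; rewrite !(mxD, mxN); ring.
have trn : \tr nabla_mx = c *+ n - \tr ricci_op.
  by rewrite nablaE !linearD linearN /= mxtrace_scalar tr_antisym // add0r.
(* The equation for div W is kept doubled, so that the contracted Bianchi identity replaces twice
   the divergence of Ric by dS without dividing. *)
have gw j : \sum_k g j k * (div_antisym X k + div_antisym X k) =
    \sum_k (ricci_mx j k * V k 0 + ricci_mx j k * V k 0) - D j (\tr ricci_op).
  have := div_mx_nabla j.
  rewrite trn derB nablaE !div_mxD div_mxN div_mx_scalar // -gX div_mx_lower //.
  rewrite [D j (c *+ n)](_ : _ = 0) ?sub0r; last first.
    by elim: (n) => [|m IH]; rewrite ?mulr0n ?der0 // mulrS derD Dc IH addr0.
  move=> E.
  under [LHS]eq_bigr do rewrite mulrDr.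
  rewrite !big_split /=.
  set a := \sum_k _ in E *; set r := \sum_k _ in E *.
  have {}E : a = div_mx ricci_op j - D j (\tr ricci_op) + r by apply/eqP;
    rewrite -addrA -E; apply/eqP; ring.
  rewrite E -contracted_bianchi; ring.
have hgx (x : 'I_n -> A) k : \sum_j h k j * (\sum_i g j i * x i) = x k.
  under eq_bigr do rewrite mulr_sumr.
  rewrite exchange_big; transitivity (\sum_i (1%:M : 'M[A]_n) k i * x i).
    apply: eq_bigr => i _; under eq_bigr do rewrite mulrA.
    by rewrite -mulr_suml -mxM hg.
  rewrite (bigD1 k) //= mxE eqxx mul1r big1 ?addr0 // => i ik.
  by rewrite mxE eq_sym (negPf ik) mul0r.
pose U k := \sum_j ricci_op j k * V j 0.
have hU k : \sum_j h k j * (\sum_m ricci_mx j m * V m 0) = U k.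
  under eq_bigr do rewrite mulr_sumr.
  rewrite exchange_big; apply: eq_bigr => m _ /=.
  under eq_bigr do rewrite mulrA.
  by rewrite -mulr_suml -mxM -mxT /ricci_op trmx_mul h_sym ricci_mx_sym.
have gradE k : grad_vec (\tr ricci_op) k + (div_antisym X k + div_antisym X k) = U k
  + U k.
  rewrite -[div_antisym X k + _](hgx (fun k => div_antisym X k + div_antisym X k)).
  under [X in _ + X]eq_bigr do rewrite gw mulrBr big_split mulrDr.
  rewrite sumrB big_split /= !hU /grad_vec; ring.
have divE : div_vec (grad_vec (\tr ricci_op)) = div_vec U + div_vec U.
  rewrite -div_vecD -(div_vec_ext gradE) div_vecD div_vecD div_div_antisym //.
  by rewrite !addr0.
rewrite divE div_vec_ricci_op nablaE.
have -> : \tr (ricci_op *m (W *m h + c%:M - ricci_op)) = c * \tr ricci_op - \tr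
  (ricci_op *m ricci_op).
  have -> : ricci_op *m (W *m h + c%:M - ricci_op) = ricci_mx *m X + c *: ricci_op -
    ricci_op *m ricci_op.
    by rewrite mulmxBr mulmxDr mul_mx_scalar /X /ricci_op !mulmxA.
  have tr0 : \tr (ricci_mx *m X) = 0.
    by rewrite mxtrace_mulC; apply: tr_antisym => //; exact: ricci_mx_sym.
  by rewrite linearB linearD linearZ /= tr0 add0r.
under [X in _ - X]eq_bigr do rewrite -contracted_bianchi mulrDr.
rewrite big_split /= -cc; ring.
Qed.

End calculus.

(** The setting is that of a change of coordinates t: [J a b] = ∂_a t^b, while
    [dg b] = (∂_b g) ∘ t and [dw b c] = (∂_b w^c) ∘ t for a metric and a vector
    field given in the target coordinates, with w ∘ t = J^T v. *)
Section lie_transform.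
Context {A : comPzRingType} {n : nat} {D : 'I_n -> A -> A}.
Hypothesis derD : forall i x y, D i (x + y) = D i x + D i y.
Hypothesis derM : forall i x y, D i (x * y) = D i x * y + x * D i y.
Implicit Types (X Y g : 'M[A]_n) (v : 'cV[A]_n).

Let dmx p q := @dmx A n D p q.

(** The derivatives are arguments because those in target coordinates, pulled back to the source,
    need not come from the derivations [D]. *)
Definition lie_form v (dg : 'I_n -> 'M[A]_n) (dv g : 'M[A]_n) : 'M[A]_n :=
  \matrix_(i, j) \sum_k (v k 0 * dg k i j + g k j * dv i k + g i k * dv j k).

Lemma lie_formE v dg dv g :
  lie_form v dg dv g = \sum_k v k 0 *: dg k + dv *m g + g *m dv^T.
Proof.
apply/matrixP => i j; rewrite mxE !mxD summxE !mxM -!big_split.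
by apply: eq_bigr => k _; rewrite /= mxE mxT (mulrC (dv i k)).
Qed.

Definition along v X := \sum_k v k 0 *: dmx k X.

Lemma alongM v X Y : along v (X *m Y) = along v X *m Y + X *m along v Y.
Proof.
rewrite /along mulmx_suml mulmx_sumr -big_split; apply: eq_bigr => k _ /=.
by rewrite /dmx dmxM // scalerDr -scalemxAl -scalemxAr.
Qed.

Lemma along_tr v X : along v X^T = (along v X)^T.
Proof.
rewrite /along linear_sum; apply: eq_bigr => k _ /=.
by rewrite /dmx dmx_tr linearZ.
Qed.

(** [along v] satisfies the Leibniz rule on [J *m g *m J^T]. Symmetry of the second derivatives of
    the coordinate change gives [J *m dw = dv *m J + along v J], which absorbs both the [dv] terms
    and the derivative of [J]. *)
Lemma lie_form_transform (J g : 'M[A]_n) (v : 'cV[A]_n)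
    (dg : 'I_n -> 'M[A]_n) (dw : 'M[A]_n) :
  (forall a k b, D a (J k b) = D k (J a b)) ->
  (forall a, dmx a g = \sum_b J a b *: dg b) ->
  (forall a b, D a ((J^T *m v) b 0) = (J *m dw) a b) ->
  let h := J *m g *m J^T in
  lie_form v (fun k => dmx k h) (\matrix_(a, b) D a (v b 0)) h =
  J *m lie_form (J^T *m v) dg dw g *m J^T.
Proof.
move=> Jsym dgE dwE h; rewrite !lie_formE -/(along v h).
set dv := \matrix_(a, b) _.
have E1 : J *m dw = dv *m J + along v J.
  apply/matrixP => a b; rewrite -dwE mxD !mxM der_sum // /along summxE -big_split.
  apply: eq_bigr => k _ /=.
  by rewrite derM mxT /dv [(\matrix_(_, _) _) a k]mxE [in RHS]mxE /dmx dmxE (Jsym k);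
    ring.
have E2 : along v g = \sum_b (J^T *m v) b 0 *: dg b.
  rewrite /along; under eq_bigr do rewrite dgE scaler_sumr.
  rewrite exchange_big; apply: eq_bigr => b _ /=.
  rewrite mxM scaler_suml; apply: eq_bigr => k _.
  by rewrite scalerA mxT mulrC.
rewrite -E2 /h !alongM along_tr.
have E3 : J *m g *m (J *m dw)^T = J *m g *m dw^T *m J^T by rewrite trmx_mul !mulmxA.
rewrite !mulmxDr !mulmxDl !mulmxA -E3 E1 linearD /= trmx_mul !mulmxDr !mulmxDl !mulmxA.
apply/matrixP => i j; rewrite !mxD; ring.
Qed.

End lie_transform.

(** * Positive definite matrices *)

Section positive_definite.
Context {R : rcfType}.

Definition posdef {n} (h : 'M[R]_n) :=
  forall v : 'rV[R]_n, v != 0 -> 0 < (v *m h *m v^T) 0 0.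

Lemma posdef_unit {n} (h : 'M[R]_n) : posdef h -> h \in unitmx.
Proof.
move=> hp; rewrite -row_free_unit -kermx_eq0; apply/rowV0P => v /sub_kermxP vh.
apply/eqP/negPn/negP => /hp; by rewrite vh mul0mx mxE ltxx.
Qed.

(** Cholesky factorization by induction on the Schur complement of the top left entry. *)
Lemma posdef_cholesky {n} (h : 'M[R]_n) : h^T = h -> posdef h ->
  exists E : 'M[R]_n, h = E *m E^T.
Proof.
move: h; elim: n => [|n IH] h hs hp; first by exists 0; rewrite flatmx0 [RHS]flatmx0.
pose h' : 'M[R]_(1 + n) := h.
pose a := h' 0 0; pose b := ursubmx h'; pose d := drsubmx h'.
have hE : h' = block_mx a%:M b b^T d.
  rewrite -[LHS]submxK; congr (block_mx _ _ _ _); last by rewrite trmx_ursub [h'^T]hs.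
  by rewrite [LHS]mx11_scalar !mxE; congr (h' _ _)%:M; apply/val_inj.
have quad (x : 'M[R]_1) (w : 'rV[R]_n) : row_mx x w *m h' *m (row_mx x w)^T =
    (x *m a%:M + w *m b^T) *m x^T + (x *m b + w *m d) *m w^T.
  by rewrite hE mul_row_block tr_row_mx mul_row_col.
have a0 : 0 < a.
  have /hp : row_mx 1%:M 0 != 0 :> 'rV[R]_(1 + n).
    apply/eqP => /(congr1 lsubmx); rewrite row_mxKl => /matrixP/(_ 0 0).
    by rewrite !mxE => /eqP; rewrite oner_eq0.
  rewrite -[h]/h' quad trmx1 mul1mx !mul0mx !addr0 mulmx1 trmx0 mulmx0 addr0.
  by rewrite mxE mulr1n.
have [||E' dE] := IH (d - a^-1 *: (b^T *m b)).
- by rewrite linearB linearZ /= trmx_mul trmxK trmx_drsub [h'^T]hs.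
(* The first coordinate that minimizes the quadratic form for given [w]; the minimum is the value of
   the Schur complement at [w]. *)
- move=> w w0; pose x := - a^-1 *: (w *m b^T).
  have /hp : row_mx x w != 0 :> 'rV[R]_(1 + n).
    apply: contra_neq w0 => /(congr1 rsubmx); by rewrite row_mxKr linear0.
  rewrite -[h]/h' quad; congr (0 < _ 0 0); pose x' := x.
  rewrite -/x'.
  have -> : x' *m a%:M + w *m b^T = 0.
    by rewrite mul_mx_scalar /x' scalerA mulrN mulfV ?gt_eqF// scaleN1r addNr.
  rewrite mul0mx add0r /x' mulmxBr -scalemxAl -scalemxAr -mulmxA scaleNr addrC.
  by rewrite mulmxA.
pose s := Num.sqrt a.
pose B : 'M[R]_(1 + n) := block_mx s%:M 0 (s^-1 *: b^T) E'.
exists B; change (h' = B *m B^T).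
rewrite hE /B tr_block_mx mulmx_block.
have s0 : s != 0 by rewrite gt_eqF ?sqrtr_gt0.
have ss : s * s = a by rewrite -expr2 sqr_sqrtr // ltW.
rewrite !trmx0 !mulmx0 mul0mx !addr0 tr_scalar_mx linearZ /= trmxK.
congr block_mx.
- by rewrite -scalar_mxM ss.
- by rewrite mul_scalar_mx scalerA mulfV // scale1r.
- by rewrite mul_mx_scalar scalerA mulfV // scale1r.
rewrite -dE -scalemxAl -scalemxAr scalerA -invfM ss addrC subrK.
by [].
Qed.

(** |T|^2 in an orthonormal frame: with [h = E *m E^T], cyclicity turns the trace into that of the
    square of the symmetric matrix [E^T *m T *m E], a sum of squares. *)
Lemma trace_square_ge0 {n} (h T : 'M[R]_n) : h^T = h -> posdef h -> T^T = T ->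
  0 <= \tr (T *m h *m (T *m h)) ?= iff (T == 0).
Proof.
move=> hs hp Ts; have [E hE] := posdef_cholesky hs hp.
have Eu : E \in unitmx.
  by move: (posdef_unit hp); rewrite hE unitmx_mul => /andP[].
pose Y := E^T *m T *m E.
have -> : \tr (T *m h *m (T *m h)) = \sum_i \sum_j Y i j ^+ 2.
  have Ys : Y^T = Y by rewrite /Y !trmx_mul trmxK Ts mulmxA.
  transitivity (\tr (Y *m Y)).
    by rewrite /Y hE !mulmxA mxtrace_mulC !mulmxA.
  apply: eq_bigr => i _; rewrite mxE; apply: eq_bigr => j _.
  by rewrite expr2; congr (_ * _); rewrite -[in LHS]Ys mxE.
have Y0 i : 0 <= \sum_j Y i j ^+ 2 by apply: sumr_ge0 => j _; exact: sqr_ge0.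
split; first by apply: sumr_ge0 => i _; exact: Y0.
rewrite eq_sym psumr_eq0 //; apply/idP/eqP => [/allP H|T0]; last first.
  by apply/allP => i _; rewrite /Y T0 mulmx0 mul0mx; apply/implyP => _;
    rewrite big1 // => j _; rewrite mxE expr0n.
have YE : Y = 0.
  apply/matrixP => i j; rewrite [RHS]mxE; apply/eqP; rewrite -sqrf_eq0.
  have /implyP/(_ isT) := H i (mem_index_enum i); rewrite psumr_eq0 => [|k _];
    last exact: sqr_ge0.
  by move=> /allP/(_ j (mem_index_enum j)).
have : T = (invmx E)^T *m Y *m invmx E.
  by rewrite /Y -!mulmxA mulmxV // mulmx1 mulmxA -trmx_mul mulmxV // trmx1 mul1mx.
by rewrite YE mulmx0 mul0mx.
Qed.
End positive_definite.

(** * Smooth functions on an open set *)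

Section smooth.
Context {R : realType} {n : nat} {U : set 'rV[R]_n}.
Hypothesis Uo : open U.
Implicit Types (f g : 'rV[R]_n -> R) (x : 'rV[R]_n) (i j : 'I_n).

Definition regular f := forall x, U x -> {for x, continuous f} /\
  (forall i, derivable f x (delta_mx 0 i)).

Lemma near_open_eq f g x : U x -> (forall y, U y -> f y = g y) ->
  \forall y \near x, f y = g y.
Proof. by move=> Ux fg; apply: (filterS fg); exact: open_nbhs_nbhs. Qed.

Lemma near_eq_for_continuous f g x : (\forall y \near x, f y = g y) ->
  {for x, continuous f} -> {for x, continuous g}.
Proof.
move=> fg cf; rewrite /prop_for /continuous_at -(nbhs_singleton fg).
exact: cvg_trans (near_eq_cvg fg) cf.
Qed.

Lemma regular_ext f g : (forall y, U y -> f y = g y) -> regular f -> regular g.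
Proof.
move=> fg fr x Ux; have [cf df] := fr x Ux; have fgx := near_open_eq Ux fg.
split; first exact: near_eq_for_continuous cf.
by move=> i; exact: near_eq_derivable (df i).
Qed.

Lemma partial_ext i f g : (forall y, U y -> f y = g y) ->
  forall y, U y -> partial i f y = partial i g y.
Proof. by move=> fg y Uy; apply: near_eq_derive; exact: near_open_eq. Qed.

Lemma foldr_partial_ext s f g : (forall y, U y -> f y = g y) ->
  forall y, U y -> foldr partial f s y = foldr partial g s y.
Proof. by move=> fg; elim: s => [//|i s IH] /=; exact: partial_ext. Qed.

Lemma smooth_on_regular f : smooth_on U f -> regular f.
Proof. by move=> fs x Ux; exact: (fs [::]). Qed.

Lemma smooth_on_partial i f : smooth_on U f -> smooth_on U (partial i f).
Proof.
move=> fs s x Ux; have := fs (rcons s i) x Ux.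
by rewrite -cats1 foldr_cat.
Qed.

(** A coinduction principle that avoids formulas for iterated derivatives. The list is peeled at its
    end because [foldr] applies the last derivative first. *)
Lemma smooth_on_coind (P : ('rV[R]_n -> R) -> Prop) f :
  (forall g, P g -> regular g) ->
  (forall g i, P g -> exists2 h, P h & forall x, U x -> partial i g x = h x) ->
  P f -> smooth_on U f.
Proof.
move=> Preg Pder Pf s; elim/last_ind: s f Pf => [|s i IH] f Pf.
  exact: Preg.
have [h Ph fh] := Pder f i Pf.
apply: regular_ext (IH h Ph) => y Uy.
rewrite -cats1 foldr_cat /=; apply: foldr_partial_ext => // z Uz.
by rewrite fh.
Qed.

Lemma smooth_on_ext f g : (forall y, U y -> f y = g y) ->
  smooth_on U f -> smooth_on U g.
Proof.
move=> fg fs s; apply: regular_ext (fs s) => y Uy.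
exact: foldr_partial_ext.
Qed.

Section rational_closure.
Context {B : ('rV[R]_n -> R) -> Prop}.

(** [B] is a parameter so that it can also contain composites with a coordinate change; their
    derivatives are only required to fall in the closure, as the chain rule provides. *)
Inductive rational_closure : ('rV[R]_n -> R) -> Prop :=
| rat_base f of B f : rational_closure f
| rat_cst (c : R) : rational_closure (cst c)
| rat_add f g of rational_closure f & rational_closure g :
    rational_closure (f + g)
| rat_mul f g of rational_closure f & rational_closure g :
    rational_closure (f * g)
| rat_inv f of (forall x, U x -> f x != 0) & rational_closure f :
    rational_closure (fun x => (f x)^-1).

Hypothesis B_regular : forall f, B f -> regular f.
Hypothesis B_partial : forall f i, B f ->
  exists2 h, rational_closure h & forall x, U x -> partial i f x = h x.

Lemma rational_closure_regular f : rational_closure f -> regular f.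
Proof.
elim=> {f} [f /B_regular //|c|f g _ fr _ gr|f g _ fr _ gr|f f0 _ fr] x Ux.
- by split=> [|i]; [exact: cst_continuous|exact: derivable_cst].
- have [[cf df] [cg dg]] := (fr x Ux, gr x Ux).
  by split=> [|i]; [exact: continuousD|exact: derivableD].
- have [[cf df] [cg dg]] := (fr x Ux, gr x Ux).
  by split=> [|i]; [exact: continuousM|exact: derivableM].
- have [cf df] := fr x Ux.
  split=> [|i]; [exact: continuousV (f0 x Ux) _|exact: derivableV (f0 x Ux) _].
Qed.

Lemma rational_closure_partial f i : rational_closure f ->
  exists2 h, rational_closure h & forall x, U x -> partial i f x = h x.
Proof.
elim=> {f} [f Bf|c|f g fr [f' f'r ff'] gr [g' g'r gg']
  |f g fr [f' f'r ff'] gr [g' g'r gg']|f f0 fr [f' f'r ff']].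
- exact: B_partial.
- exists (cst 0); first exact: rat_cst.
  by move=> x Ux; rewrite /partial derive_cst.
- exists (f' + g'); first exact: rat_add.
  move=> x Ux; rewrite /partial deriveD; last 2 first.
  + by have [] := rational_closure_regular fr Ux.
  + by have [] := rational_closure_regular gr Ux.
  by rewrite -[LHS]/(partial i f x + partial i g x) ff' // gg'.
- exists (f * g' + g * f'); first by apply: rat_add; exact: rat_mul.
  move=> x Ux; rewrite /partial deriveM; last 2 first.
  + by have [] := rational_closure_regular fr Ux.
  + by have [] := rational_closure_regular gr Ux.
  by rewrite -/(partial i f x) -/(partial i g x) ff' // gg'.
- exists (cst (-1) * (f' * ((fun x => (f x)^-1) * (fun x => (f x)^-1)))).
    apply: rat_mul; [exact: rat_cst|apply: rat_mul => //].
    by apply: rat_mul; exact: rat_inv.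
  move=> x Ux; rewrite /partial deriveV; last 2 first.
  + exact: f0.
  + by have [] := rational_closure_regular fr Ux.
  rewrite -/(partial i f x) ff' // -[RHS]/(-1 * (f' x * ((f x)^-1 * (f x)^-1))).
  by rewrite -invfM -expr2 mulN1r [LHS]mulNr mulrC.
Qed.

Lemma rational_closure_smooth f : rational_closure f -> smooth_on U f.
Proof.
apply: smooth_on_coind; first exact: rational_closure_regular.
by move=> g i; exact: rational_closure_partial.
Qed.

End rational_closure.

Lemma rational_smooth f : @rational_closure (smooth_on U) f -> smooth_on U f.
Proof.
apply: rational_closure_smooth => [g|g i gs]; first exact: smooth_on_regular.
by exists (partial i g) => //; apply: rat_base; exact: smooth_on_partial.
Qed.

Lemma smooth_on_cst (c : R) : smooth_on U (cst c).
Proof. by apply: rational_smooth; exact: rat_cst. Qed.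

Lemma smooth_onD f g : smooth_on U f -> smooth_on U g -> smooth_on U (f + g).
Proof. by move=> *; apply: rational_smooth; apply: rat_add; exact: rat_base. Qed.

Lemma smooth_onM f g : smooth_on U f -> smooth_on U g -> smooth_on U (f * g).
Proof. by move=> *; apply: rational_smooth; apply: rat_mul; exact: rat_base. Qed.

Lemma smooth_onV f : (forall x, U x -> f x != 0) -> smooth_on U f ->
  smooth_on U (fun x => (f x)^-1).
Proof. by move=> *; apply: rational_smooth; apply: rat_inv => //; exact: rat_base. Qed.

End smooth.

(** * The mean value theorem along a line *)

Section line.
Context {R : realType} {E : normedModType R}.
Implicit Types (f : E -> R) (x v : E).

Lemma is_derive_line f x v (t : R) : derivable f (t *: v + x) v ->
  is_derive t 1 (fun s : R => f (s *: v + x)) ('D_v f (t *: v + x)).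
Proof.
have E1 : (fun h : R => h^-1 *: (((fun s : R => f (s *: v + x)) \o shift t)
    (h *: 1) - f (t *: v + x))) =
    (fun h : R => h^-1 *: ((f \o shift (t *: v + x)) (h *: v) - f (t *: v + x))).
  apply/funext => h /=; congr (_ *: (f _ - _)).
  by rewrite [h *: 1]mulr1 scalerDl addrA.
move=> df; apply: DeriveDef; first by rewrite /derivable E1.
by rewrite /derive E1.
Qed.

Lemma is_derive_translate f x v w : derivable f (w + x) v ->
  is_derive x v (fun y => f (w + y)) ('D_v f (w + x)).
Proof.
have E1 : (fun h : R => h^-1 *: (((fun y => f (w + y)) \o shift x)
    (h *: v) - f (w + x))) =
    (fun h : R => h^-1 *: ((f \o shift (w + x)) (h *: v) - f (w + x))).
  by apply/funext => h /=; congr (_ *: (f _ - _)); rewrite addrCA.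
move=> df; apply: DeriveDef; first by rewrite /derivable E1.
by rewrite /derive E1.
Qed.

Lemma MVT_line f x v (h : R) :
  (forall t : R, `|t| <= `|h| -> derivable f (t *: v + x) v) ->
  exists2 t : R, `|t| <= `|h| & f (h *: v + x) - f x = h * 'D_v f (t *: v + x).
Proof.
move=> df; pose phi (s : R) := f (s *: v + x).
have dphi (t : R) : `|t| <= `|h| -> is_derive t 1 phi ('D_v f (t *: v + x)).
  by move=> /df; exact: is_derive_line.
have cphi (a b : R) : (forall t, t \in `[a, b] -> `|t| <= `|h|) ->
    {within `[a, b], continuous phi}.
  move=> ab; apply: derivable_within_continuous => t /ab /dphi []//.
have phi0 : phi 0 = f x by rewrite /phi scale0r add0r.
have [h0|h0] := leP 0 h.
  have ab t : t \in `[0, h] -> `|t| <= `|h|.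
    by rewrite in_itv /= => /andP[t0 th]; rewrite !ger0_norm.
  have [t tab] := MVT_segment h0 (fun t tab => dphi t (ab t (subset_itv_oo_cc tab)))
    (cphi _ _ ab).
  by rewrite phi0 subr0 => E1; exists t; [exact: ab|rewrite mulrC].
have ab t : t \in `[h, 0] -> `|t| <= `|h|.
  by rewrite in_itv /= => /andP[ht t0]; rewrite ler0_norm // ler0_norm ?lerN2 // ltW.
have [t tab] := MVT_segment (ltW h0) (fun t tab => dphi t (ab t (subset_itv_oo_cc tab)))
  (cphi _ _ ab).
rewrite phi0 sub0r mulrN => /(congr1 -%R); rewrite opprB opprK => E1.
by exists t; [exact: ab|rewrite mulrC].
Qed.

End line.

Lemma dist_halves {R : realFieldType} (a b c eps : R) :
  `|a - c| < eps / 2 -> `|b - c| < eps / 2 -> `|a - b| <= eps.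
Proof.
by rewrite !ltr_norml ler_norml => /andP[? ?] /andP[? ?]; apply/andP; split; lra.
Qed.

Lemma norm_delta_le1 {R : realType} {n : nat} (i : 'I_n) :
  `|delta_mx 0 i : 'rV[R]_n| <= 1.
Proof.
rewrite [leLHS]/Num.Def.normr /= mx_normrE; apply: bigmax_le => // k _.
by rewrite mxE; case: (_ && _); rewrite ?normr1 ?normr0.
Qed.

(** * Symmetry of second partial derivatives *)

Section mixed.
Context {R : realType} {n : nat} {U : set 'rV[R]_n}.
Hypothesis Uo : open U.
Implicit Types (f g : 'rV[R]_n -> R) (x : 'rV[R]_n) (i j : 'I_n).

Let e i : 'rV[R]_n := delta_mx 0 i.

(** The mean value theorem twice: along [e i] for the increment of [f] in direction [e j], then
    along [e j] for [partial i f]. *)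
Lemma second_difference f x i j (h : R) : smooth_on U f ->
  (forall s t : R, `|s| <= `|h| -> `|t| <= `|h| -> U (t *: e j + (s *: e i + x))) ->
  exists s t : R, [/\ `|s| <= `|h|, `|t| <= `|h| &
    f (h *: e j + (h *: e i + x)) - f (h *: e i + x) - (f (h *: e j + x) - f x) =
    h * (h * partial j (partial i f) (t *: e j + (s *: e i + x)))].
Proof.
move=> fs hU.
have h0 : `|0 : R| <= `|h| by rewrite normr0.
have dfi k y : U y -> derivable f y (e k).
  by move=> Uy; have [_] := smooth_on_regular fs Uy.
have hU0 (s : R) : `|s| <= `|h| -> U (s *: e i + x).
  by move=> sh; have := hU s 0 sh h0; rewrite scale0r add0r.
pose F y := f (h *: e j + y) - f y.
have hh : `|h| <= `|h| by [].
have dF (s : R) : `|s| <= `|h| -> is_derive (s *: e i + x) (e i) F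
    (partial i f (h *: e j + (s *: e i + x)) - partial i f (s *: e i + x)).
  move=> sh; apply: is_deriveB.
    by apply: is_derive_translate; apply: dfi; exact: hU.
  by apply: DeriveDef => //; apply: dfi; exact: hU0.
have [s sh|s sh FE] := @MVT_line R _ F x (e i) h; first by have [] := dF s sh.
have [t th|t th E1] := @MVT_line R _ (partial i f) (s *: e i + x) (e j) h.
  by have [_] := smooth_on_regular (smooth_on_partial i fs) (hU s t sh th); exact.
exists s, t; split=> //; rewrite -E1.
by have [_ <-] := dF s sh; rewrite -FE.
Qed.

(** The second difference is symmetric in the two directions, so the two mixed derivatives agree at
    two points near [x]; continuity brings both points to [x]. *)
Lemma partialC f x i j : smooth_on U f -> U x ->
  partial i (partial j f) x = partial j (partial i f) x.
Proof.
move=> fs Ux.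
have cont k l : {for x, continuous (partial k (partial l f))}.
  by have [] := smooth_on_regular (smooth_on_partial k (smooth_on_partial l fs)) Ux.
apply/eqP; rewrite -subr_eq0 -normr_le0; apply/ler_addgt0Pl => eps eps0.
rewrite addr0.
have /cvgrPdist_lt/(_ _ (divr_gt0 eps0 (ltr0Sn _ 1))) c1 := cont i j.
have /cvgrPdist_lt/(_ _ (divr_gt0 eps0 (ltr0Sn _ 1))) c2 := cont j i.
have nU : nbhs x U by exact: open_nbhs_nbhs.
have /nbhs_ballP[d d0 dB] : nbhs x [set y | U y /\
    (`|partial i (partial j f) x - partial i (partial j f) y| < eps / 2 /\
     `|partial j (partial i f) x - partial j (partial i f) y| < eps / 2)].
  exact: filterI nU (filterI c1 c2).
(* Two displacements of norm at most [d / 4] stay in the ball of radius [d]. *)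
pose h := d / 4.
have d0' : 0 < d by exact: d0.
have h0 : 0 < h by rewrite divr_gt0.
have inB k l (s t : R) : `|s| <= `|h| -> `|t| <= `|h| -> ball x d (t *: e k + (s *: e
  l + x)).
  move=> sh th; rewrite -ball_normE /= addrA opprD addrCA subrr addr0 normrN.
  have le1 m (r : R) : `|r| <= `|h| -> `|r *: e m| <= h.
    move=> rh; rewrite normrZ (le_trans (ler_piMr _ _)) //; first exact: norm_delta_le1.
    by rewrite (le_trans rh) // ger0_norm // ltW.
  rewrite (le_lt_trans (ler_normD _ _)) // (le_lt_trans (lerD (le1 _ _ th) (le1 _ _
    sh))) //.
  by rewrite /h; lra.
have [s' t' sh' th'|s [t [sh th E1]]] := @second_difference f x i j h fs.
  by have [] := dB _ (inB j i _ _ sh' th').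
have [s' t' sh' th'|s' [t' [sh' th' E2]]] := @second_difference f x j i h fs.
  by have [] := dB _ (inB i j _ _ sh' th').
have E : partial j (partial i f) (t *: e j + (s *: e i + x)) =
       partial i (partial j f) (t' *: e i + (s' *: e j + x)).
  apply: (mulfI (lt0r_neq0 h0)); apply: (mulfI (lt0r_neq0 h0)).
  apply: etrans (esym E1) _; apply: etrans _ E2.
  rewrite (addrCA (h *: e j)).
  move: (f _) (f _) (f _) (f _) => a b c d'; ring.
have [_ [_ B1]] := dB _ (inB j i _ _ sh th).
have [_ [B2 _]] := dB _ (inB i j _ _ sh' th').
by rewrite -E in B2; exact: dist_halves B2 B1.
Qed.

End mixed.

(** * Differentiability from continuous partial derivatives *)

Section differentiable.
Context {R : realType} {n : nat} {U : set 'rV[R]_n}.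
Hypothesis Uo : open U.
Implicit Types (f g : 'rV[R]_n -> R) (x v : 'rV[R]_n) (i j k : 'I_n).

Lemma coord_le_norm v k : `|v 0 k| <= `|v|.
Proof.
rewrite [leRHS]/Num.Def.normr /= mx_normrE.
exact: (@le_bigmax _ _ _ 0 (fun ij : 'I_1 * 'I_n => `|v ij.1 ij.2|) (0, k)).
Qed.

Lemma norm_le_coord v (c : R) : 0 <= c -> (forall k, `|v 0 k| <= c) -> `|v| <= c.
Proof.
move=> c0 vc; rewrite [leLHS]/Num.Def.normr /= mx_normrE.
by apply: bigmax_le => // -[i k] _; rewrite (ord1 i).
Qed.

Lemma smooth_differentiable f x : smooth_on U f -> U x -> differentiable f x.
Proof.
move=> fs Ux.
pose D k := partial k f x.
pose df v : R := \sum_k v 0 k * D k.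
have df_lin : linear df.
  move=> a u v; rewrite /df scaler_sumr -big_split; apply: eq_bigr => k _ /=.
  by rewrite !mxE mulrDl -mulrA.
pose dfM := GRing.isLinear.Build _ _ _ _ _ df_lin.
pose dfL : {linear _ -> _} := HB.pack df dfM.
have dfc : continuous dfL.
  move=> v; apply: differentiable_continuous.
  have -> : (dfL : _ -> _) = \sum_k (fun v : 'rV[R]_n => v 0 k) * cst (D k).
    by apply/funext => u; rewrite fct_sumE.
  by apply: differentiable_sum => k; apply: differentiableM;
    [exact: differentiable_coord|].
suff dfo : f \o shift x = cst (f x) + df +o_ (0 : 'rV[R]_n) id.
  by apply/diff_locallyP; rewrite (diff_unique dfc dfo); split.
apply/eqaddoP => _/posnumP[eps].
(* There are [n] coordinate steps; dividing by [n.+1] also covers dimension zero. *)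
pose eps' := eps%:num / n.+1%:R.
have eps'0 : 0 < eps' by rewrite divr_gt0.
have cont k : nbhs x [set y | `|D k - partial k f y| < eps'].
  have [] := smooth_on_regular (smooth_on_partial k fs) Ux.
  by move=> /cvgrPdist_lt/(_ _ eps'0).
have contA : nbhs x [set y | forall k, `|D k - partial k f y| < eps'].
  exact: (@filter_forall _ _ (fun k => [set y | `|D k - partial k f y| < eps']) (nbhs
    x) _ cont).
have nU : nbhs x U by exact: open_nbhs_nbhs.
have /nbhs_ballP[d d0 dB] : nbhs x [set y | U y /\ forall k, `|D k - partial k f y| <
  eps'].
  exact: filterI nU contA.
apply/nbhs_ballP; exists d => // v; rewrite -ball_normE /= sub0r normrN => vd.
(* A staircase from 0 to [v] that switches on one coordinate at a time. In the sup norm it never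
   exceeds [v], so it stays in the ball. *)
pose w (m : nat) : 'rV[R]_n := \row_j (if (j < m)%N then v 0 j else 0).
have wS k : w k.+1 = v 0 k *: delta_mx 0 k + w k.
  apply/rowP => j; have [->|jk] := eqVneq j k; rewrite !mxE /=.
    by rewrite eqxx ltnSn ltnn mulr1 addr0.
  by rewrite (negPf jk) mulr0 add0r ltnS leq_eqVlt (negPf (jk : val j != val k)).
have wle k (t : R) : `|t| <= `|v 0 k| -> `|t *: delta_mx 0 k + w k| <= `|v|.
  move=> tv; apply: norm_le_coord => // j; have [->|jk] := eqVneq j k; rewrite !mxE /=.
    by rewrite eqxx ltnn mulr1 addr0 (le_trans tv) // coord_le_norm.
  rewrite (negPf jk) mulr0 add0r.
  by case: ifP => _; rewrite ?normr0 // coord_le_norm.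
have wB k (t : R) : `|t| <= `|v 0 k| -> ball x d (t *: delta_mx 0 k + (w k + x)).
  move=> tv; rewrite -ball_normE /= addrA opprD addrCA subrr addr0 normrN.
  by rewrite (le_lt_trans (wle _ _ tv)).
have step k : `|f (w k.+1 + x) - f (w k + x) - v 0 k * D k| <= eps' * `|v|.
  have [t tv|t tv] := @MVT_line R _ f (w k + x) (delta_mx 0 k) (v 0 k).
    by have [Uy _] := dB _ (wB k t tv); have [_] := smooth_on_regular fs Uy.
  rewrite wS -(addrA _ (w k) x) => ->; rewrite -mulrBr normrM mulrC distrC.
  apply: ler_pM => //; last exact: coord_le_norm.
  by have [_ /(_ k)/ltW] := dB _ (wB k t tv).
have -> : (f \o shift x - (cst (f x) + dfL)) v =
    \sum_(k : 'I_n) (f (w k.+1 + x) - f (w k + x) - v 0 k * D k).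
  rewrite sumrB -(big_mkord xpredT (fun m => f (w m.+1 + x) - f (w m + x))).
  rewrite (telescope_sumr (fun m => f (w m + x))) //.
  have -> : w n = v by apply/rowP => j; rewrite mxE ltn_ord.
  have -> : w 0%N = 0 by apply/rowP => j; rewrite !mxE.
  by rewrite add0r -addrA -opprD.
rewrite (le_trans (ler_norm_sum _ _ _)) // (le_trans (ler_sum _ (fun k _ => step k)))
  //.
rewrite sumr_const card_ord -mulr_natr mulrAC ler_wpM2r // /eps' -mulrA.
by rewrite ler_piMr // mulrC ler_pdivrMr // mul1r ler_nat.
Qed.

End differentiable.

(** The value is 0 outside [U], so that equality on [U] is Leibniz equality. The
    parameter [Uo] is used by the ring structure only. *)
Record smooth_fun (R : realType) (n : nat) (U : set 'rV[R]_n) (Uo : open U) :=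
  SmoothFun {
    smf :> 'rV[R]_n -> R;
    smf_smooth : smooth_on U smf;
    smf_out : forall x, ~ U x -> smf x = 0 }.

(** * The ring of smooth functions on an open set *)

Section smooth_ring.
Context {R : realType} {n : nat} {U : set 'rV[R]_n} (Uo : open U).

Local Notation smooth_fun := (smooth_fun Uo).

Lemma smooth_fun_eq (u v : smooth_fun) : (forall x, U x -> u x = v x) -> u = v.
Proof.
case: u v => [u us u0] [v vs v0] /= uv.
have E : u = v.
  apply/funext => x; have [/uv //|Ux] := pselect (U x).
  by rewrite u0 // v0.
by case: _ / E in vs v0 uv *; congr (SmoothFun _ _); exact: Prop_irrelevance.
Qed.

HB.instance Definition _ := gen_eqMixin smooth_fun.
HB.instance Definition _ := gen_choiceMixin smooth_fun.

Definition cutoff (f : 'rV[R]_n -> R) : 'rV[R]_n -> R :=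
  fun x => if pselect (U x) then f x else 0.

Lemma cutoffE f x : U x -> cutoff f x = f x.
Proof. by rewrite /cutoff; case: pselect. Qed.

Lemma cutoff_smooth f : smooth_on U f -> smooth_on U (cutoff f).
Proof. by apply: (smooth_on_ext Uo) => x Ux; rewrite cutoffE. Qed.

Lemma cutoff_out f x : ~ U x -> cutoff f x = 0.
Proof. by rewrite /cutoff; case: pselect. Qed.

Definition to_smooth f (fs : smooth_on U f) : smooth_fun :=
  SmoothFun Uo (cutoff_smooth fs) (@cutoff_out f).

Definition smooth_zero := to_smooth (smooth_on_cst Uo 0).
Definition smooth_one := to_smooth (smooth_on_cst Uo 1).
Definition smooth_add (u v : smooth_fun) :=
  to_smooth (smooth_onD Uo (smf_smooth u) (smf_smooth v)).
Definition smooth_mul (u v : smooth_fun) :=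
  to_smooth (smooth_onM Uo (smf_smooth u) (smf_smooth v)).
Definition smooth_opp (u : smooth_fun) :=
  to_smooth (smooth_onM Uo (smooth_on_cst Uo (-1)) (smf_smooth u)).

Let addE u v x : U x -> smooth_add u v x = u x + v x.
Proof. by move=> Ux; rewrite /= cutoffE. Qed.
Let mulE u v x : U x -> smooth_mul u v x = u x * v x.
Proof. by move=> Ux; rewrite /= cutoffE. Qed.
Let oppE u x : U x -> smooth_opp u x = - u x.
Proof. by move=> Ux; rewrite /= cutoffE // -[RHS]mulN1r. Qed.
Let oneE x : U x -> smooth_one x = 1.
Proof. by move=> Ux; rewrite /= cutoffE. Qed.
Let zeroE x : U x -> smooth_zero x = 0.
Proof. by move=> Ux; rewrite /= cutoffE. Qed.

Let addA : associative smooth_add.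
Proof. by move=> u v w; apply: smooth_fun_eq => x Ux; rewrite !addE // addrA. Qed.
Let addC : commutative smooth_add.
Proof. by move=> u v; apply: smooth_fun_eq => x Ux; rewrite !addE // addrC. Qed.
Let add0 : left_id smooth_zero smooth_add.
Proof. by move=> u; apply: smooth_fun_eq => x Ux; rewrite !addE // zeroE // add0r. Qed.
Let addN : left_inverse smooth_zero smooth_opp smooth_add.
Proof. by move=> u; apply: smooth_fun_eq => x Ux;
  rewrite !addE // zeroE // oppE // addNr. Qed.

HB.instance Definition _ := GRing.isZmodule.Build smooth_fun addA addC add0 addN.

Let mulA : associative smooth_mul.
Proof. by move=> u v w; apply: smooth_fun_eq => x Ux; rewrite !mulE // mulrA. Qed.
Let mulC : commutative smooth_mul.
Proof. by move=> u v; apply: smooth_fun_eq => x Ux; rewrite !mulE // mulrC. Qed.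
Let mul1 : left_id smooth_one smooth_mul.
Proof. by move=> u; apply: smooth_fun_eq => x Ux; rewrite !mulE // oneE // mul1r. Qed.
Let mulD : left_distributive smooth_mul smooth_add.
Proof. by move=> u v w; apply: smooth_fun_eq => x Ux;
  rewrite !(mulE, addE) // mulrDl. Qed.

HB.instance Definition _ :=
  GRing.Zmodule_isComPzRing.Build smooth_fun mulA mulC mul1 mulD.

Definition smooth_partial i (u : smooth_fun) : smooth_fun :=
  to_smooth (smooth_on_partial i (smf_smooth u)).

Lemma smooth_partialE i u x : U x -> smooth_partial i u x = partial i u x.
Proof. exact: cutoffE. Qed.

Lemma to_smoothE f (fs : smooth_on U f) x : U x -> to_smooth fs x = f x.
Proof. exact: cutoffE. Qed.

Let regularE (u : smooth_fun) x i : U x -> derivable u x (delta_mx 0 i).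
Proof. by move=> Ux; have [_] := smooth_on_regular (smf_smooth u) Ux. Qed.

Lemma smooth_partialD i (u v : smooth_fun) :
  smooth_partial i (u + v) = smooth_partial i u + smooth_partial i v.
Proof.
apply: smooth_fun_eq => x Ux; rewrite smooth_partialE // addE // !smooth_partialE //.
rewrite (@partial_ext _ _ _ Uo i _ (smf u + smf v) (@addE u v) x Ux).
by rewrite /partial deriveD //; exact: regularE.
Qed.

Lemma smooth_partialM i (u v : smooth_fun) :
  smooth_partial i (u * v) = smooth_partial i u * v + u * smooth_partial i v.
Proof.
apply: smooth_fun_eq => x Ux; rewrite smooth_partialE // addE // !mulE //
  !smooth_partialE //.
rewrite (@partial_ext _ _ _ Uo i _ (smf u * smf v) (@mulE u v) x Ux).
rewrite /partial deriveM; [|exact: regularE..].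
by rewrite addrC mulrC.
Qed.

Lemma smooth_partialC i j u :
  smooth_partial i (smooth_partial j u) = smooth_partial j (smooth_partial i u).
Proof.
have E k l x : U x ->
    smooth_partial k (smooth_partial l u) x = partial k (partial l u) x.
  move=> Ux; apply: etrans (smooth_partialE _ _ Ux) _.
  exact: (partial_ext Uo k (@smooth_partialE l u) Ux).
apply: smooth_fun_eq => x Ux; apply: etrans (E i j x Ux) _.
apply: etrans _ (esym (E j i x Ux)).
exact: (partialC Uo i j (smf_smooth u) Ux).
Qed.

Section evaluation.
Context {x : 'rV[R]_n} (Ux : U x).

Lemma smfD (u v : smooth_fun) : (u + v) x = u x + v x.
Proof. exact: addE. Qed.
Lemma smfN (u : smooth_fun) : (- u) x = - u x.
Proof. exact: oppE. Qed.
Lemma smfB (u v : smooth_fun) : (u - v) x = u x - v x.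
Proof. by rewrite smfD smfN. Qed.
Lemma smfM (u v : smooth_fun) : (u * v) x = u x * v x.
Proof. exact: mulE. Qed.
Lemma smf0 : (0 : smooth_fun) x = 0.
Proof. exact: zeroE. Qed.
Lemma smf1 : (1 : smooth_fun) x = 1.
Proof. exact: oneE. Qed.
Lemma smf_sum (I : Type) (r : seq I) (P : pred I) (F : I -> smooth_fun) :
  (\sum_(i <- r | P i) F i) x = \sum_(i <- r | P i) F i x.
Proof. by apply: (big_morph (fun u : smooth_fun => u x) smfD smf0). Qed.

End evaluation.
End smooth_ring.

Section eval_morphism.
Context {R : realType} {n : nat} {U : set 'rV[R]_n} (Uo : open U).
Context {x : 'rV[R]_n}.

(** The proof of [U x] is part of the term so that the morphism structure can attach to it: outside
    [U] the unit evaluates to 0. *)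
Definition smf_at (_ : U x) (u : smooth_fun Uo) : R := u x.

Context (Ux : U x).

Fact smf_at_zmod_morphism : zmod_morphism (smf_at Ux).
Proof. by move=> u v; rewrite /smf_at smfB. Qed.
Fact smf_at_monoid_morphism : monoid_morphism (smf_at Ux).
Proof. by split=> [|u v]; rewrite /smf_at ?smf1 ?smfM. Qed.

HB.instance Definition _ := GRing.isZmodMorphism.Build (smooth_fun Uo) R
  (smf_at Ux) smf_at_zmod_morphism.
HB.instance Definition _ := GRing.isMonoidMorphism.Build (smooth_fun Uo) R
  (smf_at Ux) smf_at_monoid_morphism.

End eval_morphism.

Lemma half_soliton {R : realFieldType} (L r c m : R) :
  2^-1 * L + r = c / 2 * m -> L + (r + r) = c * m.
Proof. by move=> E; lra. Qed.

Lemma smf_mul3 {R : realType} {n : nat} {U : set 'rV[R]_n} {Uo : open U} {x} (Ux : U x)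
  (a b c d e f : smooth_fun Uo) :
  (a * b + c * d + e * f) x = a x * b x + c x * d x + e x * f x.
Proof. by rewrite !(smfD, smfM). Qed.

(** * The soliton identity in a chart *)

Section local_identity.
Context {R : realType} {n : nat} {U : set 'rV[R]_n} (Uo : open U).
Context (g : 'rV[R]_n -> 'M[R]_n) (V : 'rV[R]_n -> 'rV[R]_n) (lambda : R).
Hypothesis gs : forall i j, smooth_on U (fun x => g x i j).
Hypothesis Vs : forall i, smooth_on U (fun x => V x 0 i).
Hypothesis g_sym : forall x, U x -> (g x)^T = g x.
Hypothesis g_unit : forall x, U x -> g x \in unitmx.
Implicit Types (x : 'rV[R]_n) (i j k l : 'I_n).

Let A := smooth_fun Uo.
Let D : 'I_n -> A -> A := fun i => @smooth_partial R n U Uo i.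
Let half : A := to_smooth Uo (smooth_on_cst Uo 2^-1).
Let lam : A := to_smooth Uo (smooth_on_cst Uo lambda).
Let gA : 'M[A]_n := \matrix_(i, j) to_smooth Uo (gs i j).
Let VA : 'cV[A]_n := \col_i to_smooth Uo (Vs i).

Let gA_at x : U x -> forall i j, gA i j x = g x i j.
Proof. by move=> Ux i j; rewrite mxE to_smoothE. Qed.
Let VA_at x : U x -> forall i, VA i 0 x = V x 0 i.
Proof. by move=> Ux i; rewrite mxE to_smoothE. Qed.

Let mapgA x (Ux : U x) : map_mx (smf_at (Uo := Uo) Ux) gA = g x.
Proof. by apply/matrixP => i j; rewrite mxE -gA_at. Qed.

Let det_at x : U x -> (\det gA) x = \det (g x).
Proof. by move=> Ux; rewrite -(mapgA Ux) det_map_mx. Qed.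

Let det_neq0 x : U x -> (\det gA) x != 0.
Proof. by move=> Ux; rewrite det_at // -unitfE -unitmxE g_unit. Qed.

(** Cramer's formula for the inverse metric: only the determinant, nowhere zero on [U], has to be
    inverted. *)
Let idet : A := to_smooth Uo (smooth_onV Uo det_neq0 (smf_smooth (\det gA))).
Let hA : 'M[A]_n := idet *: \adj gA.

Let hA_at x : U x -> forall i j, hA i j x = invmx (g x) i j.
Proof.
move=> Ux i j; rewrite mxE smfM // to_smoothE // det_at //.
rewrite /invmx (g_unit Ux) [RHS]mxE; congr (_ * _).
by rewrite -(mapgA Ux) -map_mx_adj [RHS]mxE.
Qed.

Let gh : gA *m hA = 1%:M.
Proof.
rewrite -scalemxAr mul_mx_adj scale_scalar_mx.
suff -> : idet * \det gA = 1 by [].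
apply: smooth_fun_eq => x Ux.
by rewrite smfM // to_smoothE // smf1 // mulVf // det_neq0.
Qed.

Let hg : hA *m gA = 1%:M.
Proof.
rewrite -scalemxAl mul_adj_mx scale_scalar_mx.
suff -> : idet * \det gA = 1 by [].
apply: smooth_fun_eq => x Ux.
by rewrite smfM // to_smoothE // smf1 // mulVf // det_neq0.
Qed.

Let gA_sym : gA^T = gA.
Proof.
apply/matrixP => i j; apply: smooth_fun_eq => x Ux.
by rewrite mxE !gA_at // -{1}(g_sym Ux) mxE.
Qed.

Let hA_sym : hA^T = hA.
Proof.
rewrite -[LHS]mulmx1 -gh mulmxA -{1}gA_sym -trmx_mul gh.
by rewrite trmx1 mul1mx.
Qed.

Let half2 : half + half = 1.
Proof.
apply: smooth_fun_eq => x Ux; rewrite smfD // smf1 // to_smoothE // /cst.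
by rewrite [RHS]splitr mul1r.
Qed.

Lemma smooth_partial_at i (u : A) f : (forall y, U y -> u y = f y) ->
  forall y, U y -> D i u y = partial i f y.
Proof.
move=> uf y Uy; apply: etrans (smooth_partialE _ _ Uy) _.
exact: (partial_ext Uo i uf Uy).
Qed.

Let LC := @levi_civita A n D half gA hA.

Let dmetric_at k i j x : U x -> D k (gA i j) x = dmetric g k i j x.
Proof. by move=> Ux; apply: smooth_partial_at => // y Uy; exact: gA_at. Qed.

Let chr_at k i j x : U x -> LC i k j x = christoffel g k i j x.
Proof.
move=> Ux; rewrite mxE smfM // to_smoothE // smf_sum //.
congr (_ * _); apply: eq_bigr => l _.
by rewrite smfM // hA_at // smfB // smfD // !dmetric_at.
Qed.

Let riemann_at l i j k x : U x -> @curvature A n D LC i j l k x = riemann g l i j k x.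
Proof.
move=> Ux; rewrite curvatureE.
rewrite (smfD Ux).
rewrite !(smfB Ux).
rewrite /riemann sumrB.
congr (_ - _ + (_ - _)).
- by apply: smooth_partial_at => // y; exact: chr_at.
- by apply: smooth_partial_at => // y; exact: chr_at.
- by apply: etrans (smf_sum Ux _ _ _) _; apply: eq_bigr => p _;
  rewrite (smfM Ux) !chr_at.
- by apply: etrans (smf_sum Ux _ _ _) _; apply: eq_bigr => p _;
  rewrite (smfM Ux) !chr_at.
Qed.

Let ric_at j k x : U x -> @ricci_mx A n D LC j k x = ricci_local g x j k.
Proof.
move=> Ux; rewrite !mxE smf_sum //; apply: eq_bigr => i _.
exact: riemann_at.
Qed.

Let ricop := @ricci_op A n D LC hA.

Let ricop_at j k x : U x -> ricop j k x = (ricci_local g x *m invmx (g x)) j k.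
Proof.
move=> Ux; rewrite mxM smf_sum // mxE; apply: eq_bigr => l _.
by rewrite smfM // ric_at // hA_at.
Qed.

Let scalar_at x : U x -> (\tr ricop) x = scalar_local g x.
Proof.
move=> Ux; rewrite smf_sum //; apply: eq_bigr => j _.
rewrite ricop_at // mxE; apply: eq_bigr => k _.
by rewrite mulrC -!hA_at // -[in LHS]hA_sym mxE.
Qed.

Let grad_at k x : U x ->
  @grad_vec A n D hA (\tr ricop) k x = gradient_local g (scalar_local g) x 0 k.
Proof.
move=> Ux; rewrite mxE smf_sum //; apply: eq_bigr => j _.
rewrite smfM // hA_at //; congr (_ * _).
by apply: smooth_partial_at => // y; exact: scalar_at.
Qed.

Let laplacian_at x : U x -> @div_vec A n D LC (@grad_vec A n D hA (\tr ricop)) x =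
  laplacian_local g (scalar_local g) x.
Proof.
move=> Ux; rewrite /div_vec /laplacian_local /divergence_local.
rewrite smfD // big_split /= !smf_sum //; congr (_ + _).
  apply: eq_bigr => i _.
  by apply: smooth_partial_at => // y; exact: grad_at.
rewrite exchange_big; apply: eq_bigr => k _ /=.
apply: etrans (smfM Ux _ _) _; rewrite grad_at // -mulr_suml; congr (_ * _).
apply: etrans (smf_sum Ux _ _ _) _.
by apply: eq_bigr => i _; exact: chr_at.
Qed.

Let drift_at x : U x -> (\sum_j VA j 0 * D j (\tr ricop)) x =
  (V x *m g x *m (gradient_local g (scalar_local g) x)^T) 0 0.
Proof.
move=> Ux.
have -> : (gradient_local g (scalar_local g) x)^T =
    invmx (g x) *m \col_j partial j (scalar_local g) x.
  by apply/colP => k; rewrite !mxE; apply: eq_bigr => j _; rewrite mxE.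
rewrite mulmxA mulmxK ?g_unit // mxE smf_sum //; apply: eq_bigr => j _.
rewrite smfM // VA_at // mxE; congr (_ * _).
by apply: smooth_partial_at => // y; exact: scalar_at.
Qed.

Hypothesis soliton : forall x, U x ->
  2^-1 *: lie_metric_local g V x + ricci_local g x = (lambda / 2) *: g x.

Let LC_tf a k l : LC a l k = LC k l a.
Proof. by apply: levi_civita_tf; exact: gA_sym. Qed.

Let LC_metric a : @dmx A n D n n a gA = (LC a)^T *m gA + gA *m LC a.
Proof. by apply: levi_civita_metric => //; exact: smooth_partialD. Qed.

Let Dlam i : D i lam = 0.
Proof.
apply: smooth_fun_eq => y Uy; rewrite (smf0 Uo Uy).
apply: etrans (_ : partial i (cst lambda) y = 0).
  by apply: smooth_partial_at => // z Uz; exact: to_smoothE.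
by rewrite /partial derive_cst.
Qed.

Let solitonA : @nabla_mx A n D LC VA *m gA + (@nabla_mx A n D LC VA *m gA)^T
  + (@ricci_mx A n D LC + @ricci_mx A n D LC) = lam *: gA.
Proof.
rewrite -lie_metric_nabla; first last.
- exact: LC_tf.
- exact: LC_metric.
- exact: gA_sym.
apply/matrixP => i j; apply: smooth_fun_eq => x Ux.
rewrite mxD (smfD Ux) [in X in _ + X]mxD (smfD Ux) ric_at //.
rewrite [(lam *: gA) i j]mxE (smfM Ux) to_smoothE // gA_at //.
rewrite [(\matrix_(_, _) _) i j]mxE; apply: half_soliton.
have <- : 2^-1 * lie_metric_local g V x i j + ricci_local g x i j =
    lambda / 2 * g x i j.
  by have /matrixP/(_ i j) := soliton Ux; rewrite mxE [X in X + _]mxE [RHS]mxE.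
congr (_ * _ + _); rewrite [RHS]mxE.
apply: etrans (smf_sum Ux _ _ _) _; apply: eq_bigr => k _.
apply: etrans (smf_mul3 Ux _ _ _ _ _ _) _.
congr (_ * _ + _ * _ + _ * _).
- exact: VA_at.
- exact: dmetric_at.
- exact: gA_at.
- by apply: smooth_partial_at => // y Uy; exact: VA_at.
- exact: gA_at.
- by apply: smooth_partial_at => // y Uy; exact: VA_at.
Qed.

Lemma local_soliton_identity x : U x ->
  drifted_laplacian_local g V (scalar_local g) x =
  lambda * scalar_local g x -
  2 * \tr (ricci_local g x *m invmx (g x) *m (ricci_local g x *m invmx (g x))).
Proof.
move=> Ux; have := @soliton_identity A n D (@smooth_partialD _ _ _ Uo)
  (@smooth_partialM _ _ _ Uo) (@smooth_partialC _ _ _ Uo) half half2 LC hA gA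
  hA_sym gA_sym gh hg LC_metric LC_tf VA lam Dlam solitonA.
move=> /(congr1 (fun u : A => u x)).
rewrite (smfB Ux) laplacian_at // drift_at // /drifted_laplacian_local => ->.
rewrite (smfB Ux) (smfM Ux) (smfD Ux) scalar_at // to_smoothE //.
rewrite -[X in _ - X = _]mulr2n -[X in _ - X = _]mulr_natl; congr (_ - _ * _).
apply: etrans (smf_sum Ux _ _ _) _; apply: eq_bigr => i _.
rewrite mxM [RHS]mxE; apply: etrans (smf_sum Ux _ _ _) _; apply: eq_bigr => j _.
by apply: etrans (smfM Ux _ _) _; congr (_ * _); exact: ricop_at.
Qed.

End local_identity.

(** * Change of coordinates *)

Section change_of_coordinates.
Context {R : realType} {n : nat} {U W : set 'rV[R]_n}.
Hypotheses (Uo : open U) (Wo : open W).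
Context (t : 'rV[R]_n -> 'rV[R]_n).
Hypothesis ts : forall b, smooth_on U (fun x => t x 0 b).
Hypothesis tW : forall x, U x -> W (t x).
Implicit Types (f : 'rV[R]_n -> R) (x : 'rV[R]_n) (a b i j k : 'I_n).

Lemma map_differentiable x : U x -> differentiable t x.
Proof.
move=> Ux.
have -> : t = \sum_b (fun y => t y 0 b *: delta_mx 0 b).
  by apply/funext => y; rewrite fct_sumE; exact: row_sum_delta.
apply: differentiable_sum => b; apply: differentiableZl.
exact: (smooth_differentiable Uo (ts b) Ux).
Qed.

Lemma jacobianE a b x : U x -> 'J t x a b = partial a (fun y => t y 0 b) x.
Proof.
move=> Ux; have dt := map_differentiable Ux.
have := deriveEjacobian (delta_mx 0 a) dt; rewrite -rowE => /rowP/(_ b).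
rewrite [in X in _ = X]mxE => <-.
by rewrite derive_mx ?mxE //; exact: diff_derivable.
Qed.

Lemma comp_differentiable f x : smooth_on W f -> U x -> differentiable (f \o t) x.
Proof.
move=> fs Ux; apply: differentiable_comp; first exact: map_differentiable.
exact: (smooth_differentiable Wo fs (tW Ux)).
Qed.

Lemma partial_comp a f x : smooth_on W f -> U x ->
  partial a (f \o t) x = \sum_b 'J t x a b * partial b f (t x).
Proof.
move=> fs Ux; have df := smooth_differentiable Wo fs (tW Ux).
have dt := map_differentiable Ux.
rewrite /partial deriveE; last exact: comp_differentiable.
rewrite diff_comp //= -[X in 'd f (t x) X]/('d t x (delta_mx 0 a)).
rewrite -mul_rV_lin1 -rowE [row _ _]row_sum_delta linear_sum; apply: eq_bigr => b _.
by rewrite linearZ mxE deriveE.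
Qed.

(** By the chain rule a partial derivative of a composite is a sum of products of smooth functions
    and composites, so the rational closure of these two kinds is stable. *)
Lemma smooth_on_comp f : smooth_on W f -> smooth_on U (f \o t).
Proof.
pose B h := smooth_on U h \/ exists2 f, smooth_on W f & h = f \o t.
move=> fs; apply: (@rational_closure_smooth _ _ _ Uo B).
- move=> h [/smooth_on_regular//|[{fs}f fs ->]] x Ux.
  have df := comp_differentiable fs Ux.
  by split=> [|i]; [exact: differentiable_continuous|exact: diff_derivable].
- move=> h i [hs|[{fs}f fs ->]].
    exists (partial i h) => //; apply: rat_base; left.
    exact: smooth_on_partial.
  exists (\sum_b partial i (fun y => t y 0 b) * (partial b f \o t)).
    elim/big_ind: _ => [|u v|b _]; [exact: rat_cst|exact: rat_add|].
    apply: rat_mul; apply: rat_base; [left; exact: smooth_on_partial|right].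
    by exists (partial b f) => //; exact: smooth_on_partial.
  move=> x Ux; rewrite partial_comp // fct_sumE; apply: eq_bigr => b _.
  by rewrite jacobianE.
- by apply: rat_base; right; exists f.
Qed.

Context (g1 g2 : 'rV[R]_n -> 'M[R]_n) (V1 V2 : 'rV[R]_n -> 'rV[R]_n).
Hypothesis g2s : forall i j, smooth_on W (fun x => g2 x i j).
Hypothesis V1s : forall i, smooth_on U (fun x => V1 x 0 i).
Hypothesis V2s : forall i, smooth_on W (fun x => V2 x 0 i).
Hypothesis gt : forall x, U x -> g1 x = 'J t x *m g2 (t x) *m ('J t x)^T.
Hypothesis Vt : forall x, U x -> V2 (t x) = V1 x *m 'J t x.

Lemma lie_metric_localE (g : 'rV[R]_n -> 'M[R]_n) (V : 'rV[R]_n -> 'rV[R]_n) x :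
  lie_metric_local g V x = lie_form (V x)^T
    (fun k => \matrix_(i, j) partial k (fun y => g y i j) x)
    (\matrix_(a, b) partial a (fun y => V y 0 b) x) (g x).
Proof.
apply/matrixP => i j; rewrite !mxE; apply: eq_bigr => k _.
by rewrite !mxE.
Qed.

(** All target quantities are pulled back to the ring over [U]. Of the hypotheses of
    [lie_form_transform], [Jsym] is Schwarz's theorem for [t], while [dgE] and [dwE] are the chain
    rule. *)
Lemma lie_metric_local_transform x : U x -> lie_metric_local g1 V1 x =
  'J t x *m lie_metric_local g2 V2 (t x) *m ('J t x)^T.
Proof.
move=> Ux; pose A := smooth_fun Uo.
pose D : 'I_n -> A -> A := fun i => @smooth_partial R n U Uo i.
pose J : 'M[A]_n := \matrix_(a, b) to_smooth Uo (smooth_on_partial a (ts b)).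
pose g : 'M[A]_n := \matrix_(i, j) to_smooth Uo (smooth_on_comp (g2s i j)).
pose v : 'cV[A]_n := \col_i to_smooth Uo (V1s i).
pose dg k : 'M[A]_n := \matrix_(i, j)
  to_smooth Uo (smooth_on_comp (smooth_on_partial k (g2s i j))).
pose dw : 'M[A]_n := \matrix_(a, b)
  to_smooth Uo (smooth_on_comp (smooth_on_partial a (V2s b))).
have mapJ y (Uy : U y) : map_mx (smf_at (Uo := Uo) Uy) J = 'J t y.
  apply/matrixP => a b; rewrite mxE /smf_at mxE.
  by apply: etrans (to_smoothE _ _ Uy) _; rewrite jacobianE.
have mapg y (Uy : U y) : map_mx (smf_at (Uo := Uo) Uy) g = g2 (t y).
  by apply/matrixP => a b; rewrite mxE /smf_at mxE; exact: to_smoothE.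
have mapv y (Uy : U y) : map_mx (smf_at (Uo := Uo) Uy) v = (V1 y)^T.
  apply/matrixP => a b; rewrite mxE /smf_at mxE ord1 [RHS]mxE; exact: to_smoothE.
have map_h y (Uy : U y) : map_mx (smf_at (Uo := Uo) Uy) (J *m g *m J^T) = g1 y.
  by rewrite !map_mxM -map_trmx mapJ mapg gt.
have map_w y (Uy : U y) : map_mx (smf_at (Uo := Uo) Uy) (J^T *m v) = (V2 (t y))^T.
  by rewrite map_mxM -map_trmx mapJ mapv Vt // trmx_mul.
have Jsym a k b : D a (J k b) = D k (J a b).
  apply: smooth_fun_eq => y Uy.
  have E c d : D c (J d b) y = partial c (partial d (fun y => t y 0 b)) y.
    by apply: smooth_partial_at => // z Uz; rewrite mxE; exact: to_smoothE.
  by rewrite !E; exact: (partialC Uo a k (ts b) Uy).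
have dgE a : dmx (D := D) a g = \sum_b J a b *: dg b.
  apply/matrixP => i j; apply: smooth_fun_eq => y Uy.
  rewrite dmxE summxE.
  apply: etrans (_ : partial a ((fun z => g2 z i j) \o t) y = _).
    by apply: smooth_partial_at => // z Uz; rewrite mxE; exact: to_smoothE.
  rewrite partial_comp //; apply: esym; apply: etrans (smf_sum Uy _ _ _) _.
  apply: eq_bigr => b _; rewrite mxE; apply: etrans (smfM Uy _ _) _.
  rewrite -(mapJ y Uy) [in RHS]mxE; congr (_ * _).
  by rewrite mxE; exact: to_smoothE.
have dwE a b : D a ((J^T *m v) b 0) = (J *m dw) a b.
  apply: smooth_fun_eq => y Uy.
  apply: etrans (_ : partial a ((fun z => V2 z 0 b) \o t) y = _).
    apply: smooth_partial_at => // z Uz.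
    by have /colP/(_ b) := map_w z Uz; rewrite mxE [RHS]mxE.
  rewrite partial_comp // mxM; apply: esym; apply: etrans (smf_sum Uy _ _ _) _.
  apply: eq_bigr => k _; apply: etrans (smfM Uy _ _) _.
  rewrite -(mapJ y Uy) [in RHS]mxE; congr (_ * _).
  by rewrite mxE; exact: to_smoothE.
have := lie_form_transform (@smooth_partialD _ _ _ Uo) (@smooth_partialM _ _ _ Uo)
  Jsym dgE dwE.
move=> /(congr1 (map_mx (smf_at (Uo := Uo) Ux))).
rewrite !map_mxM -map_trmx mapJ.
have map_lie (v' : 'cV[A]_n) dg' dv' g' :
    map_mx (smf_at (Uo := Uo) Ux) (lie_form v' dg' dv' g') =
    lie_form (map_mx (smf_at (Uo := Uo) Ux) v')
      (fun k => map_mx (smf_at (Uo := Uo) Ux) (dg' k))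
      (map_mx (smf_at (Uo := Uo) Ux) dv') (map_mx (smf_at (Uo := Uo) Ux) g').
  apply/matrixP => i j; rewrite !mxE; apply: etrans (smf_sum Ux _ _ _) _.
  apply: eq_bigr => k _; apply: etrans (smf_mul3 Ux _ _ _ _ _ _) _.
  by rewrite !mxE.
rewrite !map_lie map_h map_w mapv mapg !lie_metric_localE => E.
apply: etrans (etrans E _).
- congr (lie_form _ _ _ _).
  + apply/funext => k; apply/matrixP => i j; rewrite mxE [RHS]mxE dmxE.
    apply: esym; apply: smooth_partial_at => // y Uy.
    by have /matrixP/(_ i j) := map_h y Uy; rewrite [in X in X = _ -> _]mxE.
  + apply/matrixP => a b; rewrite mxE [RHS]mxE [in RHS]mxE.
    apply: esym; apply: smooth_partial_at => // y Uy.
    by rewrite mxE; exact: to_smoothE.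
- congr (_ *m lie_form _ _ _ _ *m _).
  + apply/funext => k; apply/matrixP => i j; rewrite mxE [RHS]mxE [in LHS]mxE.
    exact: to_smoothE.
  + apply/matrixP => a b; rewrite mxE [RHS]mxE [in LHS]mxE.
    exact: to_smoothE.
Qed.

End change_of_coordinates.

(** * Solitons *)

Lemma posdef_invmx {R : rcfType} {n} (h : 'M[R]_n) : h^T = h -> posdef h -> posdef
  (invmx h).
Proof.
move=> hs hp v v0; have hu := posdef_unit hp.
have -> : v *m invmx h *m v^T = (v *m invmx h) *m h *m (v *m invmx h)^T.
  by rewrite mulmxKV // trmx_mul trmx_inv hs mulmxA.
apply: hp; apply: contra_neq v0 => E.
by rewrite -[v]mulmx1 -(mulVmx hu) mulmxA E mul0mx.
Qed.

Section charts.
Context {R : realType} {n : nat} {M : topologicalType} (c d : chart R n M).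

Lemma overlapP x : overlap c d x ->
  exists p, [/\ chart_dom c p, chart_dom d p, x = to_coord c p & of_coord c x = p].
Proof. by move=> [p [cp dp] <-]; exists p; rewrite to_coordK. Qed.

Lemma overlap_open : open (overlap c d).
Proof.
rewrite openE => x /overlapP[p [cp dp xp px]].
have cx : (to_coord c @` chart_dom c) x by exists p.
have nimg : nbhs x (to_coord c @` chart_dom c).
  by apply: open_nbhs_nbhs; split => //; exact: chart_img_open.
have ndom : nbhs x [set y | chart_dom d (of_coord c y)].
  apply: (of_coord_cts cx); rewrite px.
  by apply: open_nbhs_nbhs; split => //; exact: chart_dom_open.
apply: filterS (filterI nimg ndom) => y [[q cq <-]] /=.
by rewrite to_coordK // => dq; exists q.
Qed.

End charts.

Section local_ext.
Context {R : realType} {n : nat} {U : set 'rV[R]_n} (Uo : open U).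

(** Serves to replace the scalar curvature read through [of_coord] by the local formula, with which
    it is known to agree only on the image of the chart. *)
Lemma drifted_laplacian_local_ext (g : 'rV[R]_n -> 'M[R]_n) V (f1 f2 : 'rV[R]_n -> R)
  x :
  (forall y, U y -> f1 y = f2 y) -> U x ->
  drifted_laplacian_local g V f1 x = drifted_laplacian_local g V f2 x.
Proof.
move=> f12 Ux.
have gE y : U y -> gradient_local g f1 y = gradient_local g f2 y.
  move=> Uy; apply/rowP => i; rewrite !mxE; apply: eq_bigr => j _.
  by rewrite (partial_ext Uo j f12 Uy).
have lapE : laplacian_local g f1 x = laplacian_local g f2 x.
  rewrite /laplacian_local /divergence_local (gE x Ux).
  apply: eq_bigr => i _; apply: (congr1 (fun a => a + _)).
  by apply: (partial_ext Uo i _ Ux) => y Uy; rewrite (gE y Uy).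
by rewrite /drifted_laplacian_local lapE (gE x Ux).
Qed.

Lemma lie_metric_local_sym (g : 'rV[R]_n -> 'M[R]_n) V x :
  (forall y, U y -> (g y)^T = g y) -> U x ->
  (lie_metric_local g V x)^T = lie_metric_local g V x.
Proof.
move=> gs Ux; have gC y : U y -> forall i j, g y i j = g y j i.
  by move=> Uy i j; rewrite -[in LHS](gs y Uy) mxE.
apply/matrixP => i j; rewrite !mxE; apply: eq_bigr => k _.
rewrite -!addrA (gC x Ux k i) (gC x Ux j k); congr (_ * _ + _); last exact: addrC.
by apply: (partial_ext Uo) => // y Uy; exact: gC.
Qed.

End local_ext.

Lemma drifted_laplacian_local_cst {R : realType} {n : nat} (g : 'rV[R]_n -> 'M[R]_n)
  V (s : R) x :
  drifted_laplacian_local g V (cst s) x = 0.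
Proof.
have g0 y : gradient_local g (cst s) y = 0.
  apply/rowP => i; rewrite !mxE big1 // => j _.
  by rewrite /partial derive_cst mulr0.
rewrite /drifted_laplacian_local g0 trmx0 mulmx0 mxE subr0.
rewrite /laplacian_local /divergence_local big1 // => i _.
rewrite big1 => [|k _]; last by rewrite g0 mxE mulr0.
rewrite addr0; have -> : (fun y => gradient_local g (cst s) y 0 i) = cst 0.
  by apply/funext => y; rewrite g0 mxE.
by rewrite /partial derive_cst.
Qed.

(** * Trace inequalities and the pointwise bound *)

Section traces.
Context {R : realType} {n : nat} (g ric : 'M[R]_n).
Hypothesis g_sym : g^T = g.
Hypothesis g_pos : posdef g.
Hypothesis ric_sym : ric^T = ric.

Let h := invmx g.
Let gu : g \in unitmx := posdef_unit g_pos.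
Let hs : h^T = h. Proof. by rewrite /h trmx_inv g_sym. Qed.
Let hp : posdef h := posdef_invmx g_sym g_pos.

(** The squared norm of [a *: ric - b *: g]. Taking a = n and b = S gives n times Cauchy-Schwarz;
    (1, 0) and (1, λ/2) give the Ricci flat and the Einstein case. *)
Lemma trace_square_shift (a b : R) :
  0 <= a ^+ 2 * \tr (ric *m h *m (ric *m h)) - (a * b * \tr (ric *m h)) *+ 2 + b ^+ 2
    * n%:R
    ?= iff (a *: ric == b *: g).
Proof.
have Ts : (a *: ric - b *: g)^T = a *: ric - b *: g.
  by rewrite linearB !linearZ /= ric_sym g_sym.
have := trace_square_ge0 hs hp Ts; rewrite subr_eq0.
suff -> : \tr ((a *: ric - b *: g) *m h *m ((a *: ric - b *: g) *m h)) =
  a ^+ 2 * \tr (ric *m h *m (ric *m h)) - (a * b * \tr (ric *m h)) *+ 2 + b ^+ 2 *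
    n%:R by [].
have -> : (a *: ric - b *: g) *m h = a *: (ric *m h) - b%:M.
  by rewrite mulmxBl -!scalemxAl mulmxV // scalemx1.
rewrite mulmxBl !mulmxBr -!scalemxAl -!scalemxAr mul_mx_scalar mul_scalar_mx
  -scalar_mxM.
rewrite !linearB !linearZ /= !linearZ /= mxtrace_scalar -mulr_natr.
rewrite /GRing.scale /= -[b * b *+ n]mulr_natr; ring.
Qed.

End traces.

(** Here [m] is the dimension, [N] is |Ric|^2 and [c] is λ. *)
Lemma soliton_bound {R : realFieldType} (m N S c : R) : 0 < m ->
  0 <= m ^+ 2 * N - (m * S * S) *+ 2 + S ^+ 2 * m -> 2 * N <= c * S ->
  0 <= S * (m * c / 2 - S).
Proof.
move=> m0 H1 H2.
have H3 : S ^+ 2 <= m * N by rewrite -(ler_pM2l m0); lra.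
have : m * (2 * N) <= m * (c * S) by rewrite ler_pM2l.
by move=> H4; lra.
Qed.

Lemma between_of_mul_ge0 {R : realFieldType} (c S : R) :
  0 <= c -> 0 <= S * (c - S) -> 0 <= S <= c.
Proof.
move=> c0 H; have [S0|S0] := ltP S 0.
  by move: H; rewrite nmulr_rge0 // subr_le0 => /(le_trans c0)/le_lt_trans/(_ S0);
    rewrite ltxx.
rewrite /= leNgt; apply/negP => cS.
have Sp : 0 < S := le_lt_trans c0 cS.
by move: H; rewrite pmulr_rge0 // subr_ge0 leNgt cS.
Qed.

(** The left-hand side is that of [trace_square_shift] at a = 1, b = c / 2. *)
Lemma einstein_bound {R : realFieldType} (m N c : R) :
  2 * N <= c * (m * c / 2) ->
  1 ^+ 2 * N - (1 * (c / 2) * (m * c / 2)) *+ 2 + (c / 2) ^+ 2 * m <= 0.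
Proof. by move=> H; lra. Qed.

Section soliton.
Context {R : realType} {n : nat} {M : manifold R n}.
Context (g : riemannian_metric M) (V : vector_field M) (lambda : R).
Hypothesis sol : ricci_soliton g V lambda.
Implicit Types (i j : atlas M) (p : M) (x : 'rV[R]_n).

Let soliton i x : coord_img i x ->
  2^-1 *: lie_metric V g i x + ricci g i x = (lambda / 2) *: g i x.
Proof. by have [_ _] := sol; exact. Qed.

Lemma coord_img_open i : open (coord_img i).
Proof. exact: chart_img_open. Qed.

Lemma metric_posdef i x : coord_img i x -> posdef (g i x).
Proof. exact: metric_pos. Qed.

Lemma ricciE i x : coord_img i x ->
  ricci g i x = (lambda / 2) *: g i x - 2^-1 *: lie_metric V g i x.
Proof. by move=> Ux; rewrite -soliton // addrC addKr. Qed.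

Lemma ricci_sym i x : coord_img i x -> (ricci g i x)^T = ricci g i x.
Proof.
move=> Ux; rewrite ricciE // linearB !linearZ /= Defs.metric_sym //.
rewrite /lie_metric (lie_metric_local_sym (@coord_img_open i)) //.
exact: Defs.metric_sym.
Qed.

Section transition.
Context {i j : atlas M} {x : 'rV[R]_n}.
Hypothesis Ox : overlap (chart_of M i) (chart_of M j) x.

Let O := overlap (chart_of M i) (chart_of M j).
Let t := transition (chart_of M i) (chart_of M j).

Lemma overlap_coord_img y : O y -> coord_img i y.
Proof. by move=> /overlapP[p [ip jp -> _]]; exists p. Qed.

Lemma transition_coord_img y : O y -> coord_img j (t y).
Proof. by move=> /overlapP[p [ip jp -> E]]; exists p => //;
  rewrite /t /transition E. Qed.

Lemma lie_metric_transform :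
  lie_metric V g i x = 'J t x *m lie_metric V g j (t x) *m ('J t x)^T.
Proof.
apply: (@lie_metric_local_transform _ _ O (coord_img j)) => //.
- exact: overlap_open.
- exact: coord_img_open.
- exact: atlas_compat.
- exact: transition_coord_img.
- exact: metric_smooth.
- by move=> a s y Oy; apply: vf_smooth; exact: overlap_coord_img.
- exact: vf_smooth.
- by move=> y Oy; exact: metric_compat.
- by move=> y Oy; exact: vf_compat.
Qed.

Lemma ricci_transform :
  ricci g i x = 'J t x *m ricci g j (t x) *m ('J t x)^T.
Proof.
rewrite !ricciE; [|exact: transition_coord_img|exact: overlap_coord_img].
rewrite lie_metric_transform mulmxBr mulmxBl -!scalemxAr -!scalemxAl.
by rewrite (metric_compat g Ox).
Qed.

Lemma scalar_localE (f : 'rV[R]_n -> 'M[R]_n) y :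
  scalar_local f y = \tr (invmx (f y) *m (ricci_local f y)^T).
Proof.
by apply: eq_bigr => a _; rewrite mxE; apply: eq_bigr => b _; rewrite [in RHS]mxE.
Qed.

Lemma scalar_transform : scalar_local (g i) x = scalar_local (g j) (t x).
Proof.
have gi : g i x \in unitmx by apply: posdef_unit; apply: metric_posdef;
  exact: overlap_coord_img.
have gj : g j (t x) \in unitmx.
  by apply: posdef_unit; apply: metric_posdef; exact: transition_coord_img.
(* The Jacobian is a factor of the invertible matrix [g i x]. *)
have Ju : 'J t x \in unitmx.
  by move: gi; rewrite (metric_compat g Ox) -mulmxA unitmx_mul => /andP[].
have invE : invmx (g i x) = invmx ('J t x)^T *m invmx (g j (t x)) *m invmx ('J t x).
  apply: (can_inj (mulmxK gi)); rewrite mulVmx // (metric_compat g Ox) -/t.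
  rewrite !mulmxA mulmxKV // -(mulmxA _ (invmx _) (g j _)) mulVmx // mulmx1 mulVmx //.
  by rewrite unitmx_tr.
rewrite !scalar_localE invE -/(ricci g i x) ricci_transform.
rewrite !trmx_mul trmxK !mulmxA mulmxKV //.
by rewrite mxtrace_mulC !mulmxA mulmxV ?unitmx_tr // mul1mx.
Qed.

End transition.

Lemma dom_chart_at p : dom (chart_at p) p.
Proof. exact: (projT2 (cid (atlas_cover p))). Qed.

Lemma coord_chart_at p : coord_img (chart_at p) (Defs.coord (chart_at p) p).
Proof. by exists p => //; exact: dom_chart_at. Qed.

Lemma overlap_chart_at i p : dom i p ->
  overlap (chart_of M i) (chart_of M (chart_at p)) (Defs.coord i p) /\
  transition (chart_of M i) (chart_of M (chart_at p)) (Defs.coord i p) = Defs.coord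
    (chart_at p) p.
Proof.
move=> ip; split; first by exists p => //; split => //; exact: dom_chart_at.
by rewrite /transition /coord to_coordK.
Qed.

(** The chart behind [scalar_curvature] may vary with the point; differentiating it requires a
    formula in one fixed chart. *)
Lemma scalar_curvatureE i x : coord_img i x ->
  scalar_curvature g (of_coord (chart_of M i) x) = scalar_local (g i) x.
Proof.
move=> [p ip <-]; rewrite (to_coordK ip).
have [ov tE] := overlap_chart_at ip.
by rewrite (scalar_transform ov) tE.
Qed.

Lemma drifted_laplacian_scalar p (i := chart_at p) (x := Defs.coord i p) :
  drifted_laplacian g V (scalar_curvature g) p =
  lambda * scalar_curvature g p -
  2 * \tr (ricci g i x *m invmx (g i x) *m (ricci g i x *m invmx (g i x))).
Proof.
have Ux : coord_img i x := coord_chart_at p.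
rewrite /drifted_laplacian -/i -/x.
rewrite (drifted_laplacian_local_ext (@coord_img_open i) _ _ (@scalar_curvatureE i) Ux).
apply: (local_soliton_identity (@coord_img_open i)) => //.
- by move=> a b; exact: metric_smooth.
- exact: vf_smooth.
- exact: Defs.metric_sym.
- by move=> y Uy; apply: posdef_unit; exact: metric_posdef.
- exact: soliton.
Qed.

Lemma scalar_curvature_trace p (i := chart_at p) (x := Defs.coord i p) :
  scalar_curvature g p = \tr (ricci g i x *m invmx (g i x)).
Proof.
have Ux : coord_img i x := coord_chart_at p.
by rewrite /scalar_curvature scalar_localE mxtrace_mulC -/(ricci g i x) ricci_sym.
Qed.

Lemma soliton_dichotomy :
  (forall p, 0 <= drifted_laplacian g V (scalar_curvature g) p) ->
  [/\ (forall p, 0 <= scalar_curvature g p <= n%:R * lambda / 2) \/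
      (forall p, n%:R * lambda / 2 <= scalar_curvature g p <= 0),
      (lambda = 0 \/ (forall p, scalar_curvature g p = 0)) -> ricci_flat g &
      (forall p, scalar_curvature g p = n%:R * lambda / 2) -> einstein g].
Proof.
move=> H.
pose N p := \tr (ricci g (chart_at p) (Defs.coord (chart_at p) p) *m
  invmx (g (chart_at p) (Defs.coord (chart_at p) p)) *m
  (ricci g (chart_at p) (Defs.coord (chart_at p) p) *m
  invmx (g (chart_at p) (Defs.coord (chart_at p) p)))).
have N_le p : 2 * N p <= lambda * scalar_curvature g p.
  by have := H p; rewrite drifted_laplacian_scalar subr_ge0.
have shift p (a b : R) : 0 <= a ^+ 2 * N p - (a * b * scalar_curvature g p) *+ 2 + b
  ^+ 2 * n%:R
    ?= iff (a *: ricci g (chart_at p) (Defs.coord (chart_at p) p) ==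
            b *: g (chart_at p) (Defs.coord (chart_at p) p)).
  rewrite scalar_curvature_trace; apply: trace_square_shift.
  - exact/Defs.metric_sym/coord_chart_at.
  - exact/metric_posdef/coord_chart_at.
  - exact/ricci_sym/coord_chart_at.
(* Both tensors transform by the same Jacobian, so proportionality in the chosen chart at each point
   holds in every chart. *)
have globalize k : (forall p, ricci g (chart_at p) (Defs.coord (chart_at p) p) =
      k *: g (chart_at p) (Defs.coord (chart_at p) p)) ->
    forall i x, coord_img i x -> ricci g i x = k *: g i x.
  move=> Hk i x [p ip <-]; have [ov tE] := overlap_chart_at ip.
  by rewrite (ricci_transform ov) tE Hk -scalemxAr -scalemxAl (metric_compat g ov) tE.
split.
- have key p : 0 <= scalar_curvature g p * (n%:R * lambda / 2 - scalar_curvature g p).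
    (* In dimension zero the trace is an empty sum; otherwise the factor n in Cauchy-Schwarz can be
       cancelled. *)
    have [n0|n0] := posnP n.
      rewrite scalar_curvature_trace /mxtrace big1 ?mul0r // => k.
      by have := ltn_ord k; rewrite {2}n0.
    have [N0 _] := shift p n%:R (scalar_curvature g p).
    by apply: soliton_bound N0 (N_le p); rewrite ltr0n.
  (* The sign of λ alone selects the alternative, so it is the same at all points. Negative λ
     reduces to the other case by changing the sign of S. *)
  have [l0|l0] := leP 0 lambda; [left|right] => p.
    by apply: between_of_mul_ge0 (key p); rewrite divr_ge0 // mulr_ge0.
  have : 0 <= - scalar_curvature g p <= - (n%:R * lambda / 2).
    apply: between_of_mul_ge0; last by rewrite -opprD mulrNN.
    by rewrite oppr_ge0 ler_pdivrMr // mul0r mulr_ge0_le0 // ltW.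
  by rewrite oppr_ge0 lerN2 andbC.
- move=> flat i x Ux; rewrite -[RHS](scale0r (g i x)); apply: globalize Ux => p.
  have lS : lambda * scalar_curvature g p = 0.
    by case: flat => [->|->]; rewrite ?mul0r ?mulr0.
  have NS := N_le p; rewrite lS pmulr_rle0 // in NS.
  (* Equality case of |Ric|^2 >= 0, since λ S = 0 forces |Ric|^2 <= 0. *)
  have := shift p 1 0; rewrite expr1n mul1r mulr0 mul0r mul0rn subr0 expr0n mul0r
    addr0 scale1r.
  move=> sh; apply/eqP; rewrite -(ge_leif sh); exact: NS.
- move=> SE; exists (lambda / 2); apply: globalize => p.
  (* Equality case of |Ric - λ/2 g|^2 >= 0; the Einstein constant is λ/2. *)
  have := shift p 1 (lambda / 2); rewrite scale1r => sh.
  apply/eqP; rewrite -(ge_leif sh).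
  by have := N_le p; rewrite SE; exact: einstein_bound.
Qed.

End soliton.

Theorem proposition6 (R : realType) (n : nat) (M : manifold R n)
    (g : riemannian_metric M) (V : vector_field M) (lambda : R)
    (sol : ricci_soliton g V lambda) :
  ((forall p : M, 0 <= drifted_laplacian g V (scalar_curvature g) p) ->
    [/\ (forall p : M, 0 <= scalar_curvature g p <= n%:R * lambda / 2) \/
        (forall p : M, n%:R * lambda / 2 <= scalar_curvature g p <= 0),
        (lambda = 0 \/ (forall p : M, scalar_curvature g p = 0)) ->
          ricci_flat g &
        (forall p : M, scalar_curvature g p = n%:R * lambda / 2) ->
          einstein g]) /\
  ((exists s : R, forall p : M, scalar_curvature g p = s) ->
    [/\ (forall p : M, 0 <= scalar_curvature g p <= n%:R * lambda / 2) \/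
        (forall p : M, n%:R * lambda / 2 <= scalar_curvature g p <= 0),
        (lambda = 0 \/ (forall p : M, scalar_curvature g p = 0)) ->
          ricci_flat g &
        (forall p : M, scalar_curvature g p = n%:R * lambda / 2) ->
          einstein g]).
Proof.
split; first exact: (soliton_dichotomy sol).
move=> [s S_cst].
suff S0 p : drifted_laplacian g V (scalar_curvature g) p = 0.
  by apply: (soliton_dichotomy sol) => p; rewrite S0.
rewrite /drifted_laplacian.
(* Constancy on all of [M] gives this equality also off the image of the chart, where [of_coord] is
   arbitrary. *)
have -> : (fun x => scalar_curvature g (of_coord (chart_of M (chart_at p)) x)) = cst s.
  by apply/funext => x; exact: S_cst.
exact: drifted_laplacian_local_cst.
Qed.
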